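(* For every $0<\alpha<\beta<1$, there exists $x_{\alpha,\beta}\in(0,1)$ such that the function $x\mapsto E_\alpha(-x^\alpha)-E_\beta(-x^\beta)$ is negative for $x\in(0,x_{\alpha,\beta})$ and positive for $x\in(x_{\alpha,\beta},\infty)$. Moreover, $$\left(\frac{1}{\Gamma(1-\beta)\Gamma(1+\alpha)}\right)^{\frac{1}{\beta-\alpha}} < x_{\alpha,\beta} < \left(\frac{\Gamma(1+\beta)}{\Gamma(1+\alpha)}\right)^{\frac{1}{\beta-\alpha}}.$$
   Context: For $\alpha>0$, $E_\alpha$ denotes the Mittag-Leffler function $E_\alpha(z)=\sum_{n\ge 0} \frac{z^n}{\Gamma(1+n\alpha)}$, where $\Gamma$ is the Gamma function. *)

(* Defs.v *)
From Stdlib Require Import Reals.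
From Coquelicot Require Import Coquelicot.
Open Scope R_scope.

(* Euler Gamma function for s > 0: Gamma(s) = int_0^oo t^(s-1) e^(-t) dt
   (improper Riemann integral; only used at positive arguments). *)
Definition Gamma (s : R) : R :=
  RInt_gen (fun t => Rpower t (s - 1) * exp (- t)) (at_right 0) (Rbar_locally p_infty).

Definition ML (alpha z : R) : R :=
  Series (fun n : nat => z ^ n / Gamma (1 + INR n * alpha)).

(* Main.v *)
Require Import Defs.
From Stdlib Require Import Reals Lra Lia.
From Coquelicot Require Import Coquelicot.
Open Scope R_scope.

(** Write [u_a x = E_a (- x^a)]. Deforming Hankel's contour onto the negative half-line shows that [u_a] is the Laplace
    transform of an explicit probability density, proportional in the variable [r = log u] to
    [1 / (cosh (a r) + cos (a PI))]. For [a < b] the difference of two such densities has signs [+, -, +] on the line, with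
    sign changes at [- c] and [c]. Put [F = u_a - u_b]. For [x < y], matching these sign changes makes [F y - lam * F x] the
    integral of a nonnegative function for some [lam > 0], because the two total masses agree and
    [exp (- y u)] is a convex function of [exp (- x u)]: hence [F x >= 0] implies [F y > 0]. The symmetry [r -> - r] gives
    [F 1 > 0].

    The bounds on the zero come from the fractional integral equation [u_a + I^a u_a = 1]. With the monotonicity of [u_a] it
    yields [u_a x < 1 / (1 + x^a / Gamma (1 + a))], its Caputo form yields [u_b x >= 1 / (1 + Gamma (1 - b) x^b)], and the two
    are comparable at the lower bound. At the zero both fractional integrals agree, and Chebyshev's inequality gives the
    upper bound.

    In logarithmic variables every improper integral above is that of a smooth function over the whole line. *)

(** * Integrals over the line *)

(** The density and the series meet on large arcs: there [1 / (1 + z ^ (- a))] is a geometric series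
    in [z ^ (- a)], and its n-th term carries an arc version of Hankel's integral for
    [1 / Gamma (1 + n a)], whose error decays fast enough to be summed. Analytic functions are
    carried as real and imaginary parts in the coordinates [z = exp (r + i t)]; conjugation leaves
    only [0 <= t <= PI], and Cauchy's theorem becomes differentiation under a proper integral. No
    residue is computed: for [a < 1] the poles of [1 / (1 + z ^ (- a))] have arguments beyond [PI],
    and the reflection formula, which starts Hankel's formula, comes from halving the argument on a
    pole-free rectangle. [line_int] truncates symmetrically, which is enough for linearity, order,
    uniqueness and reflection; continuity is bundled with it so that every truncation is Riemann
    integrable. *)

Definition line_int (f : R -> R) (l : R) : Prop :=
  (forall t, continuous f t) /\ is_lim (fun T => RInt f (- T) T) p_infty l.

Lemma continuous_ex_RInt (f : R -> R) (a b : R) :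
  (forall t, continuous f t) -> ex_RInt f a b.
Proof. intros H. apply (ex_RInt_continuous (V := R_CompleteNormedModule)). intros; apply H. Qed.

Lemma line_int_cont (f : R -> R) (l : R) : line_int f l -> forall t, continuous f t.
Proof. intros [H _]; exact H. Qed.

Lemma is_lim_le_const (f : R -> R) (l M T0 : R) :
  is_lim f p_infty l -> (forall T, T0 < T -> f T <= M) -> l <= M.
Proof.
  intros Hl H.
  assert (Hle : Rbar_le l M).
  { apply (is_lim_le_loc f (fun _ => M) p_infty l M); auto.
    - exists T0; exact H.
    - apply is_lim_const. }
  exact Hle.
Qed.

Lemma is_lim_ge_const (f : R -> R) (l M T0 : R) :
  is_lim f p_infty l -> (forall T, T0 < T -> M <= f T) -> M <= l.
Proof.
  intros Hl H.
  assert (Hle : Rbar_le M l).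
  { apply (is_lim_le_loc (fun _ => M) f p_infty M l); auto.
    - exists T0; exact H.
    - apply is_lim_const. }
  exact Hle.
Qed.

Lemma is_lim_squeeze0 (f g : R -> R) (l T0 : R) :
  (forall T, T0 < T -> Rabs (f T - l) <= g T) -> is_lim g p_infty 0 -> is_lim f p_infty l.
Proof.
  intros H Hg. apply is_lim_spec. intros eps.
  apply is_lim_spec in Hg. destruct (Hg eps) as [M HM].
  exists (Rmax M T0). intros T HT.
  pose proof (Rmax_l M T0). pose proof (Rmax_r M T0).
  specialize (HM T ltac:(lra)). specialize (H T ltac:(lra)).
  apply Rle_lt_trans with (1 := H). rewrite Rminus_0_r in HM.
  apply Rle_lt_trans with (2 := HM). apply Rle_abs.
Qed.

Lemma is_lim_exp_lin (c : R) : 0 < c -> is_lim (fun T => exp (- (c * T))) p_infty 0.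
Proof.
  intros Hc. apply is_lim_spec. intros eps. destruct eps as [e He]. simpl.
  exists (- ln e / c). intros T HT.
  rewrite Rminus_0_r, Rabs_pos_eq by (left; apply exp_pos).
  rewrite <- (exp_ln e He). apply exp_increasing.
  assert (H := Rmult_lt_compat_l c _ _ Hc HT).
  replace (c * (- ln e / c)) with (- ln e) in H by (field; lra). lra.
Qed.

Lemma line_int_ext (f g : R -> R) (l : R) :
  (forall t, f t = g t) -> line_int f l -> line_int g l.
Proof.
  intros E [Hc Hl]. split.
  - intros t. apply (continuous_ext f g); auto.
  - apply is_lim_ext with (2 := Hl). intros T. apply RInt_ext. auto.
Qed.

Lemma line_int_plus (f g : R -> R) (l m : R) :
  line_int f l -> line_int g m -> line_int (fun t => f t + g t) (l + m).
Proof.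
  intros [Hc Hl] [Kc Kl]. split.
  - intros t. apply (continuous_plus f g); auto.
  - apply is_lim_ext with (fun T => RInt f (- T) T + RInt g (- T) T).
    + intros T. symmetry. apply (RInt_plus f g); apply continuous_ex_RInt; auto.
    + apply is_lim_plus'; auto.
Qed.

Lemma line_int_scal (f : R -> R) (l c : R) :
  line_int f l -> line_int (fun t => c * f t) (c * l).
Proof.
  intros [Hc Hl]. split.
  - intros t. apply (continuous_scal_r c f); auto.
  - apply is_lim_ext with (fun T => c * RInt f (- T) T).
    + intros T. symmetry. apply (RInt_scal f); apply continuous_ex_RInt; auto.
    + apply (is_lim_scal_l _ c p_infty l); auto.
Qed.

Lemma line_int_minus (f g : R -> R) (l m : R) :
  line_int f l -> line_int g m -> line_int (fun t => f t - g t) (l - m).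
Proof.
  intros Hf Hg.
  replace (l - m) with (l + (-1) * m) by ring.
  apply line_int_ext with (fun t => f t + (-1) * g t); [intros; ring|].
  apply line_int_plus, line_int_scal; auto.
Qed.

Lemma line_int_unique (f : R -> R) (l m : R) : line_int f l -> line_int f m -> l = m.
Proof.
  intros [_ H] [_ K]. apply is_lim_unique in H. apply is_lim_unique in K.
  rewrite H in K. now injection K.
Qed.

Lemma line_int_le (f g : R -> R) (l m : R) :
  (forall t, f t <= g t) -> line_int f l -> line_int g m -> l <= m.
Proof.
  intros E [Hc Hl] [Kc Kl].
  assert (H : Rbar_le l m).
  { apply (is_lim_le_loc (fun T => RInt f (- T) T) (fun T => RInt g (- T) T) p_infty); auto.
    exists 0. intros T HT. apply RInt_le; try (apply continuous_ex_RInt; auto); auto; lra. }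
  exact H.
Qed.

Lemma RInt_incl_le (f : R -> R) (a b c d : R) :
  (forall t, continuous f t) -> (forall t, 0 <= f t) ->
  c <= a -> a <= b -> b <= d -> RInt f a b <= RInt f c d.
Proof.
  intros Hc Hp H1 H2 H3.
  rewrite <- (RInt_Chasles f c a d) by (apply continuous_ex_RInt; auto).
  rewrite <- (RInt_Chasles f a b d) by (apply continuous_ex_RInt; auto).
  assert (0 <= RInt f c a) by (apply RInt_ge_0; auto; apply continuous_ex_RInt; auto).
  assert (0 <= RInt f b d) by (apply RInt_ge_0; auto; apply continuous_ex_RInt; auto).
  unfold plus; simpl. lra.
Qed.

Lemma RInt_le_line_int (f : R -> R) (l a b : R) :
  (forall t, 0 <= f t) -> line_int f l -> a <= b -> RInt f a b <= l.
Proof.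
  intros Hp [Hc Hl] Hab.
  apply (is_lim_ge_const _ _ _ (Rmax (Rabs a) (Rabs b)) Hl). intros T HT.
  pose proof (Rmax_l (Rabs a) (Rabs b)). pose proof (Rmax_r (Rabs a) (Rabs b)).
  pose proof (Rle_abs a). pose proof (Rle_abs b).
  pose proof (Rle_abs (- a)). pose proof (Rle_abs (- b)).
  rewrite Rabs_Ropp in *.
  apply RInt_incl_le; auto; lra.
Qed.

(** For a nonnegative integrand the truncations increase with [T], so their supremum is the
    limit. *)
Lemma line_int_bounded (f : R -> R) (M : R) :
  (forall t, continuous f t) -> (forall t, 0 <= f t) ->
  (forall T, 0 <= T -> RInt f (- T) T <= M) -> exists l, line_int f l.
Proof.
  intros Hc Hp HM.
  set (E := fun y => exists T, 0 <= T /\ y = RInt f (- T) T).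
  destruct (completeness E) as [l [Hub Hlub]].
  - exists M. intros y [T [HT ->]]. auto.
  - exists (RInt f (- 0) 0), 0. split; [lra | reflexivity].
  - exists l. split; auto. apply is_lim_spec. intros eps. destruct eps as [e He]. simpl.
    destruct (Classical_Prop.classic (exists T, 0 <= T /\ l - e < RInt f (- T) T)) as [[T0 [HT0 H0]]|Hn].
    + exists T0. intros T HT.
      assert (RInt f (- T) T <= l) by (apply Hub; exists T; split; [lra|reflexivity]).
      assert (RInt f (- T0) T0 <= RInt f (- T) T) by (apply RInt_incl_le; auto; lra).
      apply Rabs_def1; lra.
    + exfalso. assert (l <= l - e); [|lra].
      apply Hlub. intros y [T [HT ->]]. apply Rnot_lt_le. intros K. apply Hn. now exists T.
Qed.

Lemma line_int_ge0 (f : R -> R) (l : R) :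
  (forall t, 0 <= f t) -> line_int f l -> 0 <= l.
Proof.
  intros Hp Hf. assert (H := RInt_le_line_int f l 0 0 Hp Hf (Rle_refl 0)).
  rewrite RInt_point in H. exact H.
Qed.

Lemma line_int_gt0 (f : R -> R) (l t0 : R) :
  (forall t, 0 <= f t) -> 0 < f t0 -> line_int f l -> 0 < l.
Proof.
  intros Hp H0 Hf. pose proof (line_int_cont _ _ Hf) as Hc.
  assert (Hl : locally t0 (fun t => 0 < f t)).
  { apply (Hc t0). exists (mkposreal _ H0). intros y Hy.
    unfold ball in Hy; simpl in Hy; unfold AbsRing_ball, abs, minus, plus, opp in Hy; simpl in Hy.
    apply Rabs_def2 in Hy. lra. }
  destruct Hl as [d Hd].
  apply Rlt_le_trans with (RInt f (t0 - d / 2) (t0 + d / 2)).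
  - destruct d as [d Hd0]; simpl in *. apply RInt_gt_0; auto; [lra|].
    intros x Hx. apply Hd. unfold ball; simpl; unfold AbsRing_ball, abs, minus, plus, opp; simpl.
    apply Rabs_def1; lra.
  - apply RInt_le_line_int; auto. destruct d as [d Hd0]; simpl in *; lra.
Qed.

Lemma line_int_lt (f g : R -> R) (l m t0 : R) :
  (forall t, f t <= g t) -> f t0 < g t0 -> line_int f l -> line_int g m -> l < m.
Proof.
  intros H H0 Hf Hg.
  assert (0 < m - l); [|lra].
  apply (line_int_gt0 (fun t => g t - f t) _ t0).
  - intros t. specialize (H t). lra.
  - lra.
  - apply line_int_minus; auto.
Qed.

(* Dominated interchange: [g n] approximates [f] uniformly relative to the weight [b]. *)
Lemma line_int_approx (f b : R -> R) (g : nat -> R -> R) (L l : R) (ln r : nat -> R) :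
  (forall t, continuous f t) -> (forall t, 0 <= b t) -> line_int b L ->
  (forall n, line_int (g n) (ln n)) ->
  (forall n t, Rabs (f t - g n t) <= r n * b t) ->
  is_lim_seq r 0 -> is_lim_seq ln l -> line_int f l.
Proof.
  intros Hf Hb HL Hg Hr Hr0 Hln. split; auto.
  assert (Hrp : forall n, 0 <= r n * L).
  { intros n. apply (line_int_ge0 (fun t => r n * b t)).
    - intros t. eapply Rle_trans; [apply Rabs_pos | apply Hr].
    - apply line_int_scal; auto. }
  assert (Hd : forall n T, 0 <= T ->
    Rabs (RInt f (- T) T - RInt (g n) (- T) T) <= r n * L).
  { intros n T HT.
    assert (Hgc := line_int_cont _ _ (Hg n)). assert (Hbc := line_int_cont _ _ HL).
    assert (Hrb : line_int (fun t => r n * b t) (r n * L)) by (apply line_int_scal; auto).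
    assert (Hi : ex_RInt (fun t => f t - g n t) (- T) T).
    { apply continuous_ex_RInt. intros t. apply (continuous_minus f (g n)); auto. }
    assert (E : RInt f (- T) T - RInt (g n) (- T) T = RInt (fun t => f t - g n t) (- T) T).
    { symmetry. apply (RInt_minus f (g n)); apply continuous_ex_RInt; auto. }
    rewrite E.
    apply Rle_trans with (RInt (fun t => r n * b t) (- T) T).
    - apply Rle_trans with (RInt (fun t => Rabs (f t - g n t)) (- T) T).
      + apply abs_RInt_le; auto. lra.
      + apply RInt_le; auto; [lra| |apply continuous_ex_RInt; apply (line_int_cont _ _ Hrb)].
        apply continuous_ex_RInt. intros t. apply (continuous_comp (fun t => f t - g n t) Rabs).
        * apply (continuous_minus f (g n)); auto.
        * apply continuous_Rabs.
    - apply RInt_le_line_int; auto; [|lra]. intros t.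
      eapply Rle_trans; [apply Rabs_pos | apply Hr]. }
  apply is_lim_spec. intros eps. destruct eps as [e He]. simpl.
  apply is_lim_seq_spec in Hln.
  assert (HrL : is_lim_seq (fun n => r n * L) 0).
  { replace (Finite 0) with (Rbar_mult 0 L) by (simpl; f_equal; ring).
    apply is_lim_seq_scal_r; auto. }
  apply is_lim_seq_spec in HrL.
  assert (He3 : 0 < e / 3) by lra.
  destruct (Hln (mkposreal _ He3)) as [N1 HN1]. destruct (HrL (mkposreal _ He3)) as [N2 HN2].
  simpl in *. set (N := max N1 N2).
  specialize (HN1 N ltac:(unfold N; lia)). specialize (HN2 N ltac:(unfold N; lia)).
  destruct (Hg N) as [_ HgN]. apply is_lim_spec in HgN.
  destruct (HgN (mkposreal _ He3)) as [M HM]. simpl in HM.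
  exists (Rmax M 0). intros T HT. pose proof (Rmax_l M 0). pose proof (Rmax_r M 0).
  specialize (HM T ltac:(lra)). specialize (Hd N T ltac:(lra)).
  rewrite Rminus_0_r, Rabs_pos_eq in HN2 by apply Hrp.
  apply Rabs_def2 in HN1. apply Rabs_def2 in HM.
  apply Rabs_le_between in Hd. apply Rabs_def1; lra.
Qed.

(** * The Gamma function *)

Ltac cont_tac := apply (ex_derive_continuous (K := R_AbsRing) (V := R_NormedModule)); auto_derive.

(* Coquelicot states equalities in carriers of algebraic structures, which [ring] and [field] do not see as [R]. *)
Ltac eq_R := match goal with |- ?a = ?b => change (@eq R a b) end.

Lemma RInt_exp_lin (c a b : R) : c <> 0 ->
  RInt (fun t => exp (c * t)) a b = (exp (c * b) - exp (c * a)) / c.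
Proof.
  intros Hc. apply is_RInt_unique.
  replace ((exp (c * b) - exp (c * a)) / c) with
    (minus (exp (c * b) / c) (exp (c * a) / c)) by (unfold minus, plus, opp; simpl; field; auto).
  apply (is_RInt_derive (fun t => exp (c * t) / c)); intros x _.
  - auto_derive; auto. field; auto.
  - cont_tac; auto.
Qed.

(** The growing exponential is used on the negative half-line and the decaying one on the positive
    half-line; each contributes at most its total mass there. *)
Lemma RInt_dominated (f : R -> R) (C c d T : R) :
  0 < c -> 0 < d -> (forall t, continuous f t) -> (forall t, 0 <= f t) ->
  (forall t, f t <= C * exp (c * t)) -> (forall t, f t <= C * exp (- d * t)) ->
  0 <= T -> RInt f (- T) T <= C * / c + C * / d.
Proof.
  intros Hc Hd Hf Hp H1 H2 HT.
  assert (HC : 0 <= C).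
  { specialize (H1 0). rewrite Rmult_0_r, exp_0 in H1. specialize (Hp 0). lra. }
  rewrite <- (RInt_Chasles f (- T) 0 T) by (apply continuous_ex_RInt; auto).
  assert (Hs : forall k, forall t, continuous (fun t => C * exp (k * t)) t) by (intros; cont_tac; auto).
  assert (Hi : forall k a b, k <> 0 -> RInt (fun t => C * exp (k * t)) a b
    = C * ((exp (k * b) - exp (k * a)) / k)).
  { intros k a b Hk. rewrite <- RInt_exp_lin; auto.
    apply (RInt_scal (fun t => exp (k * t))). apply continuous_ex_RInt. intros; cont_tac; auto. }
  apply Rplus_le_compat.
  - apply Rle_trans with (RInt (fun t => C * exp (c * t)) (- T) 0).
    + apply RInt_le; auto; try lra; apply continuous_ex_RInt; auto.
    + rewrite Hi by lra. apply Rmult_le_compat_l; auto.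
      rewrite Rmult_0_r, exp_0. pose proof (exp_pos (c * - T)).
      unfold Rdiv. rewrite <- (Rmult_1_l (/ c)) at 2. apply Rmult_le_compat_r; [|lra].
      left; apply Rinv_0_lt_compat; auto.
  - apply Rle_trans with (RInt (fun t => C * exp (- d * t)) 0 T).
    + apply RInt_le; auto; try lra; apply continuous_ex_RInt; auto.
    + rewrite Hi by lra. apply Rmult_le_compat_l; auto.
      rewrite Rmult_0_r, exp_0. pose proof (exp_pos (- d * T)).
      replace ((exp (- d * T) - 1) / - d) with ((1 - exp (- d * T)) * / d) by (field; lra).
      rewrite <- (Rmult_1_l (/ d)) at 2. apply Rmult_le_compat_r; [|lra].
      left; apply Rinv_0_lt_compat; auto.
Qed.

Lemma line_int_dominated (f : R -> R) (C c d : R) :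
  0 < c -> 0 < d -> (forall t, continuous f t) -> (forall t, 0 <= f t) ->
  (forall t, f t <= C * exp (c * t)) -> (forall t, f t <= C * exp (- d * t)) ->
  exists l, line_int f l /\ l <= C * / c + C * / d.
Proof.
  intros Hc Hd Hf Hp H1 H2.
  destruct (line_int_bounded f (C * / c + C * / d)) as [l Hl]; auto.
  - intros T HT. apply RInt_dominated; auto.
  - exists l. split; auto. apply (is_lim_le_const _ _ _ 0 (proj2 Hl)).
    intros T HT. apply RInt_dominated; auto; lra.
Qed.

(** This is the tangent line to [exp] at [ln c], the one of slope [c]: it lets [exp r] absorb a
    linear term [c * r]. *)
Lemma exp_ge_lin (c r : R) : 0 < c -> c * (1 + r - ln c) <= exp r.
Proof.
  intros Hc. replace r with (ln c + (r - ln c)) at 2 by ring.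
  rewrite exp_plus, exp_ln by auto. apply Rmult_le_compat_l; [lra|].
  pose proof (exp_ineq1_le (r - ln c)). lra.
Qed.

(* Integrand of [Gamma s] after the substitution [t = exp r]. *)
Definition gamma_kernel (s r : R) : R := exp (s * r - exp r).

Lemma continuous_gamma_kernel (s r : R) : continuous (gamma_kernel s) r.
Proof. unfold gamma_kernel. cont_tac; auto. Qed.

Lemma gamma_kernel_pos (s r : R) : 0 < gamma_kernel s r.
Proof. apply exp_pos. Qed.

Lemma exp_le_le (x y : R) : x <= y -> exp x <= exp y.
Proof. intros [H| ->]; [left; apply exp_increasing; auto | lra]. Qed.

Lemma gamma_kernel_ex_line_int (s : R) : 0 < s -> exists l, line_int (gamma_kernel s) l.
Proof.
  intros Hs.
  (* [M] is the maximum of [(s + 1) * r - exp r], reached at [r = ln (s + 1)]; hence the kernel is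
     at most [exp M * exp (- r)]. *)
  set (M := (s + 1) * (ln (s + 1) - 1)).
  destruct (line_int_dominated (gamma_kernel s) (exp (Rmax 0 M)) s 1) as [l [Hl _]]; [lra|lra| | | | |eauto].
  - intros; apply continuous_gamma_kernel.
  - intros; left; apply gamma_kernel_pos.
  - intros t. unfold gamma_kernel. rewrite <- exp_plus. apply exp_le_le.
    pose proof (Rmax_l 0 M). pose proof (exp_pos t). lra.
  - intros t. unfold gamma_kernel. rewrite <- exp_plus. apply exp_le_le.
    pose proof (Rmax_r 0 M). pose proof (exp_ge_lin (s + 1) t ltac:(lra)). unfold M in *. lra.
Qed.

(** The two endpoints in [Gamma] tend to 0 and infinity independently. After [t = exp r], positivity
    squeezes each such integral between a symmetric truncation and the limit. *)
Lemma Gamma_line_int (s : R) : 0 < s -> line_int (gamma_kernel s) (Gamma s).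
Proof.
  intros Hs. destruct (gamma_kernel_ex_line_int s Hs) as [l Hl].
  enough (E : Gamma s = l) by (rewrite E; exact Hl).
  unfold Gamma. apply (is_RInt_gen_unique (V := R_CompleteNormedModule)).
  assert (HI : forall a b, 0 < a -> a <= b ->
    is_RInt (fun t => Rpower t (s - 1) * exp (- t)) a b (RInt (gamma_kernel s) (ln a) (ln b))).
  { intros a b Ha Hab.
    apply (is_RInt_ext (fun y => scal (/ y) (gamma_kernel s (ln y)))).
    - intros x Hx. rewrite Rmin_left, Rmax_right in Hx by auto.
      assert (Hx0 : 0 < x) by lra. unfold scal, gamma_kernel, Rpower; simpl; unfold mult; simpl.
      rewrite <- exp_plus, exp_ln by auto.
      rewrite <- (exp_ln x) at 1 by auto. rewrite <- exp_Ropp, <- exp_plus.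
      f_equal. ring.
    - apply (is_RInt_comp (V := R_CompleteNormedModule) (gamma_kernel s) ln).
      + intros; apply continuous_gamma_kernel.
      + intros x Hx. rewrite Rmin_left, Rmax_right in Hx by auto. split.
        * auto_derive; [lra | field; lra].
        * cont_tac; lra. }
  intros P [e HP]. destruct Hl as [Hc Hl]. pose proof (conj Hc Hl) as Hl'. apply is_lim_spec in Hl.
  destruct (Hl e) as [M HM]. set (T := Rmax M 0 + 1).
  assert (HT : M < T /\ 0 < T) by (unfold T; pose proof (Rmax_l M 0); pose proof (Rmax_r M 0); lra).
  destruct HT as [HMT HT]. specialize (HM T HMT).
  exists (fun a => 0 < a < exp (- T)) (fun b => exp T < b).
  - exists (mkposreal _ (exp_pos (- T))). intros y Hy Hy0.
    unfold ball in Hy; simpl in Hy; unfold AbsRing_ball, abs, minus, plus, opp in Hy; simpl in Hy.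
    apply Rabs_def2 in Hy. lra.
  - exists (exp T). auto.
  - intros a b [Ha0 Ha] Hb. simpl.
    assert (exp (- T) < exp T) by (apply exp_increasing; lra).
    exists (RInt (gamma_kernel s) (ln a) (ln b)). split; [apply HI; lra|].
    apply HP. unfold ball; simpl; unfold AbsRing_ball, abs, minus, plus, opp; simpl.
    assert (K1 : ln a < - T). { rewrite <- (ln_exp (- T)). apply ln_increasing; auto. }
    assert (K2 : T < ln b). { rewrite <- (ln_exp T) at 1. apply ln_increasing; auto. apply exp_pos. }
    assert (RInt (gamma_kernel s) (- T) T <= RInt (gamma_kernel s) (ln a) (ln b)).
    { apply RInt_incl_le; auto; try lra. intros; left; apply gamma_kernel_pos. }
    assert (RInt (gamma_kernel s) (ln a) (ln b) <= l).
    { apply RInt_le_line_int; auto; try lra. intros; left; apply gamma_kernel_pos. }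
    apply Rabs_def2 in HM. apply Rabs_def1; lra.
Qed.

Lemma Gamma_pos (s : R) : 0 < s -> 0 < Gamma s.
Proof.
  intros Hs. apply (line_int_gt0 (gamma_kernel s) _ 0).
  - intros; left; apply gamma_kernel_pos.
  - apply gamma_kernel_pos.
  - apply Gamma_line_int; auto.
Qed.

Lemma line_int_derive (g f : R -> R) (lm lp : R) :
  (forall t, is_derive g t (f t)) -> (forall t, continuous f t) ->
  is_lim (fun T => g (- T)) p_infty lm -> is_lim g p_infty lp -> line_int f (lp - lm).
Proof.
  intros Hg Hf Hm Hp. split; auto.
  apply is_lim_ext with (fun T => g T - g (- T)).
  - intros T. symmetry. apply is_RInt_unique. apply (is_RInt_derive g f); auto.
  - apply is_lim_minus'; auto.
Qed.

Lemma gamma_kernel_lim_p (s : R) : is_lim (gamma_kernel s) p_infty 0.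
Proof.
  set (c := Rmax s 0 + 1). assert (Hc : s + 1 <= c /\ 1 <= c) by
    (unfold c; pose proof (Rmax_l s 0); pose proof (Rmax_r s 0); lra).
  apply (is_lim_squeeze0 _ (fun T => exp (c * (ln c - 1)) * exp (- (1 * T))) 0 0).
  - intros T HT. rewrite Rminus_0_r, Rabs_pos_eq by (left; apply gamma_kernel_pos).
    unfold gamma_kernel. rewrite <- exp_plus. apply exp_le_le.
    pose proof (exp_ge_lin c T ltac:(lra)).
    assert (0 <= (c - (s + 1)) * T) by (apply Rmult_le_pos; lra). lra.
  - replace (Finite 0) with (Rbar_mult (exp (c * (ln c - 1))) 0) by (simpl; f_equal; ring).
    apply is_lim_scal_l. apply is_lim_exp_lin. lra.
Qed.

Lemma gamma_kernel_lim_m (s : R) : 0 < s -> is_lim (fun T => gamma_kernel s (- T)) p_infty 0.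
Proof.
  intros Hs. apply (is_lim_squeeze0 _ (fun T => exp (- (s * T))) 0 0).
  - intros T HT. rewrite Rminus_0_r, Rabs_pos_eq by (left; apply gamma_kernel_pos).
    unfold gamma_kernel. apply exp_le_le. pose proof (exp_pos (- T)). lra.
  - apply is_lim_exp_lin; auto.
Qed.

(** Integration by parts: the difference of the two integrands is the derivative of
    [gamma_kernel s], which vanishes at both ends. *)
Lemma Gamma_succ (s : R) : 0 < s -> Gamma (1 + s) = s * Gamma s.
Proof.
  intros Hs.
  assert (H : line_int (fun r => s * gamma_kernel s r - gamma_kernel (1 + s) r) (0 - 0)).
  { apply (line_int_derive (gamma_kernel s)).
    - intros t. unfold gamma_kernel. auto_derive; auto.
      replace ((1 + s) * t - exp t) with (t + (s * t - exp t)) by ring.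
      rewrite (exp_plus t). unfold Rminus. ring.
    - intros t. unfold gamma_kernel. cont_tac; auto.
    - apply gamma_kernel_lim_m; auto.
    - apply gamma_kernel_lim_p. }
  assert (K := line_int_minus _ _ _ _ (line_int_scal _ _ s (Gamma_line_int s Hs))
    (Gamma_line_int (1 + s) ltac:(lra))).
  pose proof (line_int_unique _ _ _ H K). lra.
Qed.

Lemma Gamma_1 : Gamma 1 = 1.
Proof.
  apply (line_int_unique (gamma_kernel 1)); [apply Gamma_line_int; lra|].
  replace 1 with (0 - (- 1)) at 2 by ring.
  apply (line_int_derive (fun t => - gamma_kernel 0 t)).
  - intros t. unfold gamma_kernel. auto_derive; auto.
    replace (1 * t - exp t) with (t + (0 * t - exp t)) by ring. rewrite (exp_plus t). unfold Rminus. ring.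
  - intros; apply continuous_gamma_kernel.
  - apply (is_lim_squeeze0 _ (fun T => exp (- (1 * T))) _ 0).
    + intros T HT. unfold gamma_kernel.
      replace (0 * - T - exp (- T)) with (- exp (- T)) by ring.
      pose proof (exp_ineq1_le (- exp (- T))). pose proof (exp_pos (- T)).
      assert (exp (- exp (- T)) <= 1) by (rewrite <- exp_0; apply exp_le_le; lra).
      rewrite Rmult_1_l. apply Rabs_le. lra.
    + apply is_lim_exp_lin; lra.
  - replace (Finite 0) with (Rbar_opp 0) by (simpl; f_equal; ring).
    apply is_lim_opp. apply gamma_kernel_lim_p.
Qed.

(** Only the part [r >= k] of the integral is kept, and [exp (s * r)] is replaced there by
    [exp (s * k)]. As [k] is free, Gamma outgrows every geometric sequence, so the Mittag-Leffler
    series is entire. *)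
Lemma Gamma_lower (s k : R) : 0 <= s -> exp (s * k) * exp (- exp k) <= Gamma (1 + s).
Proof.
  intros Hs.
  assert (HL := Gamma_line_int (1 + s) ltac:(lra)).
  assert (Hb : forall T, k < T -> exp (s * k) * (exp (- exp k) - gamma_kernel 0 T) <= Gamma (1 + s)).
  { intros T HT.
    apply Rle_trans with (RInt (gamma_kernel (1 + s)) k T).
    - apply Rle_trans with (RInt (fun r => exp (s * k) * gamma_kernel 1 r) k T).
      + right. symmetry. apply is_RInt_unique.
        replace (exp (s * k) * (exp (- exp k) - gamma_kernel 0 T)) with
          (minus (- (exp (s * k) * gamma_kernel 0 T)) (- (exp (s * k) * gamma_kernel 0 k))).
        2: { unfold minus, plus, opp, gamma_kernel; simpl.
             replace (0 * k - exp k) with (- exp k) by ring. ring. }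
        apply (is_RInt_derive (fun t => - (exp (s * k) * gamma_kernel 0 t))).
        * intros t _. unfold gamma_kernel. auto_derive; auto.
          replace (1 * t - exp t) with (t + (0 * t - exp t)) by ring. rewrite (exp_plus t). unfold Rminus. ring.
        * intros t _. unfold gamma_kernel. cont_tac; auto.
      + apply RInt_le; try lra.
        * apply continuous_ex_RInt. intros t. unfold gamma_kernel. cont_tac; auto.
        * apply continuous_ex_RInt. intros; apply continuous_gamma_kernel.
        * intros x Hx. unfold gamma_kernel. rewrite <- exp_plus. apply exp_le_le.
          assert (s * k <= s * x) by (apply Rmult_le_compat_l; lra). lra.
    - apply RInt_le_line_int; auto; try lra. intros; left; apply gamma_kernel_pos. }
  assert (Hl : is_lim (fun T => exp (s * k) * (exp (- exp k) - gamma_kernel 0 T)) p_infty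
     (Rbar_mult (exp (s * k)) (exp (- exp k) - 0))).
  { apply is_lim_scal_l. apply is_lim_minus'; [apply is_lim_const | apply gamma_kernel_lim_p]. }
  simpl in Hl. rewrite Rminus_0_r in Hl.
  exact (is_lim_le_const _ _ _ k Hl Hb).
Qed.

(** * Parametric integrals and the Beta integral *)

Lemma continuous_RInt_param (f : R -> R -> R) (c d x0 : R) :
  c <= d -> (forall t, continuity_2d_pt f x0 t) -> (forall x t, continuous (f x) t) ->
  continuous (fun x => RInt (f x) c d) x0.
Proof.
  intros Hcd H2 Hf. apply continuity_pt_filterlim.
  intros e He.
  (* The [+ 1] keeps the denominator positive when [c = d]. *)
  assert (He' : 0 < e / (d - c + 1)) by (apply Rdiv_lt_0_compat; lra).
  destruct (uniform_continuity_2d_1d' f c d x0 (fun x _ => H2 x) (mkposreal _ He')) as [[del Hdel] H].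
  simpl in H. exists del. split; [exact Hdel|]. intros x [_ Hx].
  simpl in *. unfold Rdist in *.
  assert (E : RInt (f x) c d - RInt (f x0) c d = RInt (fun t => f x t - f x0 t) c d).
  { symmetry. apply (RInt_minus (f x) (f x0)); apply continuous_ex_RInt; auto. }
  rewrite E.
  apply Rle_lt_trans with ((d - c) * (e / (d - c + 1))).
  - apply abs_RInt_le_const; auto.
    + apply continuous_ex_RInt. intros t. apply (continuous_minus (f x) (f x0)); auto.
    + intros t Ht. left. apply Rabs_def2 in Hx. apply H; try lra.
      rewrite Rminus_diag, Rabs_R0. auto.
  - rewrite Rmult_comm. apply Rlt_le_trans with (e / (d - c + 1) * (d - c + 1)).
    + apply Rmult_lt_compat_l; auto. lra.
    + right. field. lra.
Qed.

Lemma continuity_2d_pt_fst_snd (f : R -> R -> R) (x t : R) :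
  continuity_2d_pt f x t -> continuous (f x) t.
Proof.
  intros H. apply continuity_pt_filterlim. intros e He.
  destruct (H (mkposreal e He)) as [d Hd]. exists d. split; [apply cond_pos|].
  intros y [_ Hy]. simpl in *. unfold Rdist in *. apply Hd; auto.
  rewrite Rminus_diag, Rabs_R0. apply cond_pos.
Qed.

Lemma continuity_2d_pt_swap (f : R -> R -> R) (x t : R) :
  continuity_2d_pt f x t -> continuity_2d_pt (fun u v => f v u) t x.
Proof.
  intros H e. destruct (H e) as [d Hd]. exists d. intros u v Hu Hv. auto.
Qed.

(** Differentiation under the integral sign, with hypotheses only on an open strip around [[c, d]]:
    the integrands to come have poles outside such a strip, while the endpoints need two-sided
    neighbourhoods. *)
Lemma is_derive_RInt_smooth_param (p dp : R -> R -> R) (l h c d x : R) :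
  l < c -> c <= d -> d < h ->
  (forall x t, l < t < h -> is_derive (fun u => p u t) x (dp x t)) ->
  (forall x t, l < t < h -> continuity_2d_pt dp x t) ->
  (forall x t, l < t < h -> continuous (p x) t) ->
  is_derive (fun x => RInt (p x) c d) x (RInt (dp x) c d).
Proof.
  intros Hlc Hcd Hdh Hp Hdp Hc.
  rewrite <- (RInt_ext (fun t => Derive (fun u => p u t) x)).
  2: { intros t Ht. rewrite Rmin_left, Rmax_right in Ht by auto.
       apply is_derive_unique. apply Hp; lra. }
  apply (is_derive_RInt_param p); rewrite ?Rmin_left, ?Rmax_right by auto.
  - exists (mkposreal 1 Rlt_0_1). intros y _ t Ht.
    exists (dp y t). apply Hp; lra.
  - intros t Ht. apply (continuity_2d_pt_ext_loc dp); [|apply Hdp; lra].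
    assert (He : 0 < Rmin (t - l) (h - t)) by (apply Rmin_pos; lra).
    exists (mkposreal _ He). simpl. intros u v _ Hv.
    pose proof (Rmin_l (t - l) (h - t)). pose proof (Rmin_r (t - l) (h - t)).
    apply Rabs_def2 in Hv. symmetry. apply is_derive_unique. apply Hp; lra.
  - exists (mkposreal 1 Rlt_0_1). intros y _.
    apply (ex_RInt_continuous (V := R_CompleteNormedModule)).
    intros t Ht. rewrite Rmin_left, Rmax_right in Ht by auto. apply Hc; lra.
Qed.

(** As functions of [b], both sides have the same derivative and vanish at [b = a]. *)
Lemma RInt_swap (f : R -> R -> R) (a b c d : R) :
  (forall x y, continuity_2d_pt f x y) -> a <= b -> c <= d ->
  RInt (fun x => RInt (f x) c d) a b = RInt (fun y => RInt (fun x => f x y) a b) c d.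
Proof.
  intros H Hab Hcd.
  assert (H1 : forall x t, continuous (f x) t) by (intros; apply continuity_2d_pt_fst_snd; auto).
  assert (H2 : forall y t, continuous (fun x => f x y) t).
  { intros y t. apply (continuity_2d_pt_fst_snd (fun u v => f v u)).
    apply continuity_2d_pt_swap; auto. }
  set (G := fun b' => RInt (fun y => RInt (fun x => f x y) a b') c d).
  assert (HG : forall x, is_derive G x (RInt (f x) c d)).
  { intros x. apply (is_derive_RInt_smooth_param (fun b' y => RInt (fun x => f x y) a b') f (c - 1) (d + 1)); try lra.
    - intros b' y _. apply (is_derive_RInt (fun x => f x y) _ a).
      + exists (mkposreal 1 Rlt_0_1). intros z _. apply (RInt_correct (V := R_CompleteNormedModule)).
        apply continuous_ex_RInt; auto.
      + apply H2.
    - auto.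
    - intros b' y _.
      destruct (Rle_dec a b') as [Hl|Hl].
      + apply (continuous_RInt_param (fun y x => f x y)); auto.
        intros t. apply continuity_2d_pt_swap; auto.
      + apply (continuous_ext (fun y => opp (RInt (fun x => f x y) b' a))).
        * intros z. apply opp_RInt_swap. apply continuous_ex_RInt; auto.
        * apply (continuous_opp (fun y => RInt (fun x => f x y) b' a)).
          apply (continuous_RInt_param (fun y x => f x y)); auto; [lra|].
          intros t. apply continuity_2d_pt_swap; auto. }
  transitivity (minus (G b) (G a)).
  - apply is_RInt_unique. apply (is_RInt_derive G); intros x _; auto.
    apply continuous_RInt_param; auto.
  - unfold G. rewrite (RInt_ext (fun y => RInt (fun x => f x y) a a) (fun _ => 0)).
    + rewrite RInt_const. unfold minus, plus, opp, scal; simpl; unfold mult; simpl. ring.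
    + intros. apply (RInt_point (V := R_CompleteNormedModule)).
Qed.

(* Cauchy's theorem on a rectangle for the holomorphic function [p + i q] of [r + i t]; only
   one of the two Cauchy-Riemann equations is needed. *)
Lemma contour_shift (p q dp : R -> R -> R) (l h t0 t1 a b : R) :
  l < t0 -> t0 <= t1 -> t1 < h ->
  (forall r t, l < t < h -> is_derive (fun u => p u t) r (dp r t)) ->
  (forall r t, l < t < h -> is_derive (q r) t (dp r t)) ->
  (forall r t, l < t < h -> continuity_2d_pt dp r t) ->
  (forall r t, l < t < h -> continuous (p r) t) ->
  (forall r t, l < t < h -> continuous (fun u => q u t) r) ->
  RInt (p b) t0 t1 - RInt (p a) t0 t1 = RInt (fun r => q r t1 - q r t0) a b.
Proof.
  intros Hl H01 Hh Hp Hq Hdp Hpc Hqc. symmetry.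
  assert (E : forall r, RInt (dp r) t0 t1 = q r t1 - q r t0).
  { intros r. apply is_RInt_unique.
    apply (is_RInt_derive (q r)); intros t Ht; rewrite Rmin_left, Rmax_right in Ht by auto.
    - apply Hq; lra.
    - apply continuity_2d_pt_fst_snd, Hdp; lra. }
  apply is_RInt_unique.
  apply (is_RInt_derive (fun r => RInt (p r) t0 t1)).
  - intros r _. rewrite <- E. apply (is_derive_RInt_smooth_param p dp l h); auto.
  - intros r _. apply (continuous_minus (fun r => q r t1) (fun r => q r t0)); apply Hqc; lra.
Qed.

(** The left side is the squared modulus of [1 + m exp (i t)], which vanishes only if
    [m exp (i t) = - 1]. *)
Lemma norm_1p_polar_pos (m t : R) : 0 < m -> - PI < t < PI ->
  0 < (1 + m * cos t) * (1 + m * cos t) + m * sin t * (m * sin t).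
Proof.
  intros Hm Ht.
  destruct (Req_dec t 0) as [->|Hn].
  - rewrite cos_0, sin_0. assert (0 < (1 + m * 1) * (1 + m * 1)) by (apply Rmult_lt_0_compat; lra). lra.
  - assert (Hs : m * sin t <> 0).
    { apply Rmult_integral_contrapositive_currified; [lra|].
      destruct (Rlt_le_dec 0 t).
      - apply Rgt_not_eq, sin_gt_0; lra.
      - replace t with (- - t) by ring. rewrite sin_neg.
        apply Rlt_not_eq. assert (0 < sin (- t)) by (apply sin_gt_0; lra). lra. }
    pose proof (Rle_0_sqr (1 + m * cos t)). pose proof (Rsqr_pos_lt _ Hs).
    unfold Rsqr in *. lra.
Qed.

(** The quotient is the real part of [(c + i s) / (a + i b)], a complex number of modulus at most
    [1 / d]. *)
Lemma Rabs_quot_le (c s a b d : R) :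
  c * c + s * s = 1 -> 0 < d -> d * d <= a * a + b * b ->
  Rabs ((c * a + s * b) / (a * a + b * b)) <= / d.
Proof.
  intros H1 Hd H.
  assert (HD : 0 < a * a + b * b) by (assert (0 < d * d) by (apply Rmult_lt_0_compat; auto); lra).
  unfold Rdiv. rewrite Rabs_mult, (Rabs_pos_eq (/ (a * a + b * b))) by (left; apply Rinv_0_lt_compat; auto).
  apply Rmult_le_reg_r with (a * a + b * b); auto. rewrite Rmult_assoc, Rinv_l, Rmult_1_r by lra.
  apply Rmult_le_reg_l with d; auto. rewrite <- Rmult_assoc, Rinv_r, Rmult_1_l by lra.
  rewrite <- (Rabs_pos_eq d) by lra. rewrite <- Rabs_mult.
  rewrite <- (Rabs_pos_eq (a * a + b * b)) by lra.
  apply Rsqr_le_abs_0. unfold Rsqr.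
  (* Lagrange's identity for the vectors [(c, s)] and [(a, b)]. *)
  assert (E : (c * a + s * b) * (c * a + s * b) = a * a + b * b - (c * b - s * a) * (c * b - s * a)).
  { replace (a * a + b * b) with ((c * c + s * s) * (a * a + b * b)) by (rewrite H1; ring). ring. }
  replace (d * (c * a + s * b) * (d * (c * a + s * b))) with
    (d * d * ((c * a + s * b) * (c * a + s * b))) by ring.
  apply Rmult_le_compat; auto.
  - apply Rle_0_sqr.
  - apply Rle_0_sqr.
  - rewrite E. pose proof (Rle_0_sqr (c * b - s * a)). unfold Rsqr in *. lra.
Qed.

Ltac cont2d :=
  repeat first
  [ apply continuity_2d_pt_const | apply continuity_2d_pt_id1 | apply continuity_2d_pt_id2
  | apply continuity_2d_pt_plus | apply continuity_2d_pt_minus | apply continuity_2d_pt_opp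
  | apply continuity_2d_pt_mult | apply continuity_2d_pt_inv
  | apply (continuity_1d_2d_pt_comp exp); [apply derivable_continuous_pt, derivable_pt_exp|]
  | apply (continuity_1d_2d_pt_comp cos); [apply continuity_cos|]
  | apply (continuity_1d_2d_pt_comp sin); [apply continuity_sin|] ].

(* Integrand of the Beta integral after the substitution [t = exp v / (1 + exp v)]. *)
Definition beta_kernel (p q v : R) : R := exp (q * v - (p + q) * ln (1 + exp v)).

Lemma exp_1p_pos (v : R) : 0 < 1 + exp v.
Proof. pose proof (exp_pos v); lra. Qed.

Lemma beta_kernel_pos (p q v : R) : 0 < beta_kernel p q v.
Proof. apply exp_pos. Qed.

Lemma continuous_beta_kernel (p q v : R) : continuous (beta_kernel p q) v.
Proof. unfold beta_kernel. cont_tac; auto. apply exp_1p_pos. Qed.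

Lemma ln_1p_exp_pos (v : R) : 0 < ln (1 + exp v).
Proof. rewrite <- ln_1. apply ln_increasing; [lra|]. pose proof (exp_pos v); lra. Qed.

Lemma ln_1p_exp_ge (v : R) : v <= ln (1 + exp v).
Proof.
  rewrite <- (ln_exp v) at 1. left. apply ln_increasing; [apply exp_pos|]. lra.
Qed.

Lemma beta_kernel_ex_line_int (p q : R) : 0 < p -> 0 < q -> exists l, line_int (beta_kernel p q) l /\ l <= / q + / p.
Proof.
  intros Hp Hq. rewrite <- (Rmult_1_l (/ q)), <- (Rmult_1_l (/ p)).
  apply (line_int_dominated _ 1 q p); auto.
  - intros; apply continuous_beta_kernel.
  - intros; left; apply beta_kernel_pos.
  - intros v. rewrite Rmult_1_l. apply exp_le_le.
    pose proof (ln_1p_exp_pos v).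
    assert (0 <= (p + q) * ln (1 + exp v)) by (apply Rmult_le_pos; lra). lra.
  - intros v. rewrite Rmult_1_l. apply exp_le_le.
    pose proof (ln_1p_exp_ge v).
    assert (0 <= (p + q) * (ln (1 + exp v) - v)) by (apply Rmult_le_pos; lra). lra.
Qed.

Lemma RInt_shift (f : R -> R) (t a b : R) : (forall x, continuous f x) ->
  RInt (fun v => f (t + v)) a b = RInt f (t + a) (t + b).
Proof.
  intros Hf.
  assert (H := RInt_comp_lin f 1 t a b (continuous_ex_RInt f _ _ Hf)).
  replace (t + a) with (1 * a + t) by ring. replace (t + b) with (1 * b + t) by ring.
  rewrite <- H. apply RInt_ext. intros x _. unfold scal; simpl; unfold mult; simpl.
  rewrite Rmult_1_l. f_equal; ring.
Qed.

Lemma RInt_scal_cont (f : R -> R) (k a b : R) : (forall x, continuous f x) ->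
  RInt (fun v => k * f v) a b = k * RInt f a b.
Proof. intros Hf. apply (RInt_scal f). apply continuous_ex_RInt; auto. Qed.

(** Because [exp t + exp (t + v) = exp (t + ln (1 + exp v))], the product is at fixed [v] a shifted
    Gamma integrand in [t], while at fixed [t] it is one in [v]. *)
Lemma gamma_beta_kernel (p q t v : R) :
  gamma_kernel p t * gamma_kernel q (t + v) =
  beta_kernel p q v * gamma_kernel (p + q) (ln (1 + exp v) + t).
Proof.
  unfold gamma_kernel, beta_kernel. rewrite <- !exp_plus. f_equal.
  rewrite !exp_plus, exp_ln by apply exp_1p_pos. ring.
Qed.

(** The double integral of [K] is taken in both orders, over finite rectangles only. Each inequality
    encloses a product of truncations in the integral over a larger rectangle, swaps, and bounds the
    inner integral by its full value. *)
Lemma Beta_line_int (p q : R) : 0 < p -> 0 < q ->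
  line_int (beta_kernel p q) (Gamma p * Gamma q / Gamma (p + q)).
Proof.
  intros Hp Hq. destruct (beta_kernel_ex_line_int p q Hp Hq) as [L [HL _]].
  enough (E : Gamma p * Gamma q = L * Gamma (p + q)).
  { rewrite E. replace (L * Gamma (p + q) / Gamma (p + q)) with L; auto.
    field. apply Rgt_not_eq, Gamma_pos; lra. }
  pose proof (Gamma_line_int p Hp) as HGp. pose proof (Gamma_line_int q Hq) as HGq.
  pose proof (Gamma_line_int (p + q) ltac:(lra)) as HGpq.
  pose proof (Gamma_pos q Hq) as Pq. pose proof (Gamma_pos (p + q) ltac:(lra)) as Ppq.
  assert (gpos : forall s t, 0 <= gamma_kernel s t) by (intros; left; apply gamma_kernel_pos).
  assert (bpos : forall t, 0 <= beta_kernel p q t) by (intros; left; apply beta_kernel_pos).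
  pose proof continuous_gamma_kernel as gc. pose proof (continuous_beta_kernel p q) as bc.
  set (K := fun t v => gamma_kernel p t * gamma_kernel q (t + v)).
  assert (K2 : forall t v, continuity_2d_pt K t v).
  { intros. unfold K, gamma_kernel. cont2d. }
  assert (Kc1 : forall t v, continuous (K t) v) by (intros; apply continuity_2d_pt_fst_snd; auto).
  assert (Kc2 : forall v t, continuous (fun t => K t v) t).
  { intros v t. apply (continuity_2d_pt_fst_snd (fun u v => K v u)), continuity_2d_pt_swap; auto. }
  assert (I1 : forall t a b, RInt (K t) a b = gamma_kernel p t * RInt (gamma_kernel q) (t + a) (t + b)).
  { intros. unfold K. rewrite <- RInt_shift by auto.
    apply (RInt_scal_cont (fun v => gamma_kernel q (t + v))).
    intros; unfold gamma_kernel; cont_tac; auto. }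
  assert (I2 : forall v a b, RInt (fun t => K t v) a b =
     beta_kernel p q v * RInt (gamma_kernel (p + q)) (ln (1 + exp v) + a) (ln (1 + exp v) + b)).
  { intros. rewrite <- RInt_shift by auto.
    rewrite <- RInt_scal_cont by (intros; unfold gamma_kernel; cont_tac; auto).
    apply RInt_ext. intros. apply gamma_beta_kernel. }
  assert (C1 : forall a b, a <= b -> forall t, continuous (fun t => RInt (K t) a b) t).
  { intros. apply continuous_RInt_param; auto. }
  assert (C2 : forall a b, a <= b -> forall v, continuous (fun v => RInt (fun t => K t v) a b) v).
  { intros. apply (continuous_RInt_param (fun v t => K t v)); auto.
    intros; apply continuity_2d_pt_swap; auto. }
  apply Rle_antisym.
  - apply (is_lim_le_const (fun T => RInt (gamma_kernel p) (- T) T * RInt (gamma_kernel q) (- T) T) _ _ 0).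
    { apply (is_lim_mult _ _ _ (Gamma p) (Gamma q)); [apply HGp | apply HGq | exact I]. }
    intros T HT.
    (* For [t] in [[- T, T]], the interval [[t - 2 T, t + 2 T]] contains [[- T, T]]. *)
    apply Rle_trans with (RInt (fun t => RInt (K t) (- (2 * T)) (2 * T)) (- T) T).
    + rewrite Rmult_comm, <- RInt_scal_cont by auto.
      apply RInt_le; try lra; try (apply continuous_ex_RInt; auto).
      * intros t. apply (continuous_scal_r _ (gamma_kernel p)); auto.
      * apply C1; lra.
      * intros t Ht. rewrite I1, Rmult_comm. apply Rmult_le_compat_l; auto.
        apply RInt_incl_le; auto; lra.
    + rewrite RInt_swap by (auto; lra).
      apply Rle_trans with (RInt (fun v => Gamma (p + q) * beta_kernel p q v) (- (2 * T)) (2 * T)).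
      * apply RInt_le; try lra; try (apply continuous_ex_RInt; auto).
        -- apply C2; lra.
        -- intros t. apply (continuous_scal_r _ (beta_kernel p q)); auto.
        -- intros v _. rewrite I2, Rmult_comm. apply Rmult_le_compat_r; auto.
           apply RInt_le_line_int; auto; lra.
      * rewrite RInt_scal_cont, Rmult_comm by auto. apply Rmult_le_compat_r; [lra|].
        apply RInt_le_line_int; auto; lra.
  - apply (is_lim_le_const (fun T => RInt (beta_kernel p q) (- T) T * RInt (gamma_kernel (p + q)) (- T) T) _ _ 1).
    { apply (is_lim_mult _ _ _ L (Gamma (p + q))); [apply HL | apply HGpq | exact I]. }
    intros T HT.
    (* The shift [ln (1 + exp v)] lies between 0 and [2 T] when [v <= T] and [T > 1], so the shifted
       [[- 3 T, T]] contains [[- T, T]]. *)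
    apply Rle_trans with (RInt (fun v => RInt (fun t => K t v) (- (3 * T)) T) (- T) T).
    + rewrite Rmult_comm, <- RInt_scal_cont by auto.
      apply RInt_le; try lra; try (apply continuous_ex_RInt; auto).
      * intros t. apply (continuous_scal_r _ (beta_kernel p q)); auto.
      * apply C2; lra.
      * intros v Hv. rewrite I2, Rmult_comm. apply Rmult_le_compat_l; auto.
        pose proof (ln_1p_exp_pos v).
        assert (ln (1 + exp v) <= 2 * T).
        { rewrite <- (ln_exp (2 * T)). apply Rlt_le, ln_increasing; [apply exp_1p_pos|].
          replace (2 * T) with (T + T) by ring. rewrite exp_plus.
          assert (exp v < exp T) by (apply exp_increasing; lra).
          pose proof (exp_ineq1_le T). assert (2 * exp T <= exp T * exp T).
          { apply Rmult_le_compat_r; lra. } lra. }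
        apply RInt_incl_le; auto; lra.
    + rewrite <- RInt_swap by (auto; lra).
      apply Rle_trans with (RInt (fun v => Gamma q * gamma_kernel p v) (- (3 * T)) T).
      * apply RInt_le; try lra; try (apply continuous_ex_RInt; auto).
        -- apply C1; lra.
        -- intros t. apply (continuous_scal_r _ (gamma_kernel p)); auto.
        -- intros v _. rewrite I1, Rmult_comm. apply Rmult_le_compat_r; auto.
           apply RInt_le_line_int; auto; lra.
      * rewrite RInt_scal_cont, Rmult_comm by auto. apply Rmult_le_compat_r; [lra|].
        apply RInt_le_line_int; auto; lra.
Qed.

(** * The reflection formula *)

Definition refl_int (s : R) : R := Gamma (1 - s) * Gamma s.

Lemma exp_double (x : R) : exp (2 * x) = exp x * exp x.
Proof. rewrite <- exp_plus. f_equal. ring. Qed.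

Lemma beta_kernel_refl (s v : R) : beta_kernel (1 - s) s v = exp (s * v) / (1 + exp v).
Proof.
  unfold beta_kernel, Rdiv. rewrite <- (exp_ln (1 + exp v)) at 2 by apply exp_1p_pos.
  rewrite <- exp_Ropp, <- exp_plus. f_equal. ring.
Qed.

Lemma refl_line_int (s : R) : 0 < s < 1 -> line_int (fun v => exp (s * v) / (1 + exp v)) (refl_int s).
Proof.
  intros Hs. apply (line_int_ext (beta_kernel (1 - s) s)).
  - intros t. apply beta_kernel_refl.
  - unfold refl_int. replace (Gamma (1 - s) * Gamma s) with (Gamma (1 - s) * Gamma s / Gamma (1 - s + s)).
    + apply Beta_line_int; lra.
    + replace (1 - s + s) with 1 by ring. rewrite Gamma_1. field.
Qed.

Lemma line_int_scale (f : R -> R) (l k : R) : 0 < k ->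
  line_int f l -> line_int (fun r => k * f (k * r)) l.
Proof.
  intros Hk [Hc Hl]. split.
  - intros t. apply (continuous_scal_r k (fun r => f (k * r))).
    apply (continuous_comp (fun r => k * r) f); auto. cont_tac; auto.
  - apply is_lim_ext with (fun T => RInt f (- (k * T)) (k * T)).
    + intros T.
      assert (H := RInt_comp_lin f k 0 (- T) T (continuous_ex_RInt f _ _ Hc)).
      replace (k * - T + 0) with (- (k * T)) in H by ring.
      replace (k * T + 0) with (k * T) in H by ring.
      rewrite <- H. apply RInt_ext. intros x _. unfold scal; simpl; unfold mult; simpl.
      now rewrite Rplus_0_r.
    + apply (is_lim_comp (fun T => RInt f (- T) T) (fun T => k * T) p_infty l p_infty); auto.
      * apply is_lim_spec. intros M. exists (M / k). intros x Hx.
        apply (Rmult_lt_compat_l k) in Hx; auto.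
        replace (k * (M / k)) with M in Hx by (field; lra). exact Hx.
      * exists 0. intros y _. discriminate.
Qed.

Lemma Rabs_RInt_le_const (f : R -> R) (a b M : R) :
  a <= b -> (forall t, a <= t <= b -> continuous f t) ->
  (forall t, a <= t <= b -> Rabs (f t) <= M) -> Rabs (RInt f a b) <= (b - a) * M.
Proof.
  intros Hab Hc HM. apply abs_RInt_le_const; auto.
  apply (ex_RInt_continuous (V := R_CompleteNormedModule)).
  intros t Ht. rewrite Rmin_left, Rmax_right in Ht by auto. auto.
Qed.

(* Shift of the contour of [exp (s z) / (1 + exp z)] from the real line to [Im z = PI / 2],
   the constant phase [exp (i (1 - s) PI / 2)] being chosen to make the integrand on the shifted line simple. *)
Lemma refl_quarter_turn (s : R) : 0 < s < 1 ->
  line_int (fun v => exp (s * v) / (1 + exp (2 * v))) (cos (s * (PI / 2)) * refl_int s).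
Proof.
  intros Hs. pose proof PI_RGT_0 as HPI.
  set (phi := PI / 2 - s * (PI / 2)).
  set (p := fun r t => exp (s * r) * ((cos (s * t + phi) * (1 + exp r * cos t) + sin (s * t + phi) * (exp r * sin t))
     / ((1 + exp r * cos t) * (1 + exp r * cos t) + (exp r * sin t) * (exp r * sin t)))).
  set (q := fun r t => exp (s * r) * ((sin (s * t + phi) * (1 + exp r * cos t) - cos (s * t + phi) * (exp r * sin t))
     / ((1 + exp r * cos t) * (1 + exp r * cos t) + (exp r * sin t) * (exp r * sin t)))).
  set (dp := fun r t => s * p r t -
     (p r t * (exp r * cos t * (1 + exp r * cos t) + exp r * sin t * (exp r * sin t))
       - q r t * (exp r * sin t * (1 + exp r * cos t) - exp r * cos t * (exp r * sin t)))
     * / ((1 + exp r * cos t) * (1 + exp r * cos t) + (exp r * sin t) * (exp r * sin t))).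
  assert (HD : forall r t, - PI < t < PI ->
    (1 + exp r * cos t) * (1 + exp r * cos t) + (exp r * sin t) * (exp r * sin t) <> 0).
  { intros r t Ht. apply Rgt_not_eq, norm_1p_polar_pos; auto. apply exp_pos. }
  assert (Hsh : forall T, RInt (p T) 0 (PI / 2) - RInt (p (- T)) 0 (PI / 2)
     = RInt (fun r => q r (PI / 2) - q r 0) (- T) T).
  { intros T. apply (contour_shift p q dp (- PI) PI); try lra; intros r t Ht; specialize (HD r t Ht).
    - unfold p, dp, p, q. auto_derive; auto. field; auto.
    - unfold dp, p, q. auto_derive; auto. field; auto.
    - unfold dp, p, q, Rdiv. cont2d; auto.
    - unfold p. cont_tac; auto.
    - unfold q. cont_tac; auto. }
  assert (Hq1 : forall r, q r (PI / 2) = exp (s * r) / (1 + exp (2 * r))).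
  { intros r. unfold q. replace (s * (PI / 2) + phi) with (PI / 2) by (unfold phi; ring).
    rewrite cos_PI2, sin_PI2, exp_double. field. pose proof (exp_pos r).
     apply Rgt_not_eq; nra. }
  assert (Hq0 : forall r, q r 0 = cos (s * (PI / 2)) * (exp (s * r) / (1 + exp r))).
  { intros r. unfold q. rewrite Rmult_0_r, Rplus_0_l. unfold phi.
    rewrite sin_shift, cos_shift, cos_0, sin_0. field. pose proof (exp_pos r).
     apply Rgt_not_eq; nra. }
  assert (Hcs : forall u, cos u * cos u + sin u * sin u = 1).
  { intros u. pose proof (sin2_cos2 u). unfold Rsqr in *. lra. }
  assert (Hpc : forall r t, - PI < t < PI -> continuous (p r) t).
  { intros r t Ht. specialize (HD r t Ht). unfold p. cont_tac; auto. }
  (* As [cos t >= 0] here, the modulus of [1 + exp z] is at least 1 and at least [exp r]. The first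
     bound makes the left edge of the rectangle vanish in the limit, the second ([Hp2]) the right
     edge. *)
  assert (Hp1 : forall r t, 0 <= t <= PI / 2 -> Rabs (p r t) <= exp (s * r)).
  { intros r t Ht. unfold p. rewrite Rabs_mult, (Rabs_pos_eq (exp _)) by (left; apply exp_pos).
    rewrite <- (Rmult_1_r (exp (s * r))) at 2. apply Rmult_le_compat_l; [left; apply exp_pos|].
    rewrite <- Rinv_1. apply Rabs_quot_le; auto; try lra.
    assert (0 <= exp r * cos t) by (apply Rmult_le_pos; [left; apply exp_pos | apply cos_ge_0; lra]).
    pose proof (Rle_0_sqr (exp r * sin t)). unfold Rsqr in *. nra. }
  assert (Hp2 : forall r t, 0 <= t <= PI / 2 -> Rabs (p r t) <= exp (s * r) * / exp r).
  { intros r t Ht. unfold p. rewrite Rabs_mult, (Rabs_pos_eq (exp _)) by (left; apply exp_pos).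
    apply Rmult_le_compat_l; [left; apply exp_pos|].
    pose proof (exp_pos r).
    apply Rabs_quot_le; auto; try lra.
    assert (0 <= exp r * cos t) by (apply Rmult_le_pos; [left; apply exp_pos | apply cos_ge_0; lra]).
    replace ((1 + exp r * cos t) * (1 + exp r * cos t) + exp r * sin t * (exp r * sin t))
      with (1 + 2 * (exp r * cos t) + exp r * exp r * (cos t * cos t + sin t * sin t)) by ring.
    rewrite Hcs. lra. }
  apply (line_int_ext (fun v => (q v (PI / 2) - q v 0) + cos (s * (PI / 2)) * (exp (s * v) / (1 + exp v)))).
  { intros t. rewrite Hq0, Hq1. ring. }
  replace (cos (s * (PI / 2)) * refl_int s) with (0 + cos (s * (PI / 2)) * refl_int s) by ring.
  apply line_int_plus; [|apply line_int_scal, refl_line_int; auto].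
  split.
  - intros t. apply (continuous_minus (fun v => q v (PI / 2)) (fun v => q v 0)); unfold q; cont_tac;
    apply HD; lra.
  - apply is_lim_ext with (1 := Hsh).
    replace (Finite 0) with (Finite (0 - 0)) by (f_equal; ring).
    apply is_lim_minus'.
    + apply (is_lim_squeeze0 _ (fun T => PI / 2 * exp (- ((1 - s) * T))) _ 0).
      * intros T HT. rewrite Rminus_0_r. replace (PI / 2) with (PI / 2 - 0) at 2 by ring.
        apply Rabs_RInt_le_const; [lra| |].
        -- intros; apply Hpc; lra.
        -- intros t Ht. eapply Rle_trans; [apply Hp2; lra|]. right.
           rewrite <- exp_Ropp, <- exp_plus. f_equal. ring.
      * replace (Finite 0) with (Rbar_mult (PI / 2) 0) by (simpl; f_equal; ring).
        apply is_lim_scal_l, is_lim_exp_lin. lra.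
    + apply (is_lim_squeeze0 _ (fun T => PI / 2 * exp (- (s * T))) _ 0).
      * intros T HT. rewrite Rminus_0_r. replace (PI / 2) with (PI / 2 - 0) at 2 by ring.
        apply Rabs_RInt_le_const; [lra| |].
        -- intros; apply Hpc; lra.
        -- intros t Ht. eapply Rle_trans; [apply Hp1; lra|]. right. f_equal. ring.
      * replace (Finite 0) with (Rbar_mult (PI / 2) 0) by (simpl; f_equal; ring).
        apply is_lim_scal_l, is_lim_exp_lin. lra.
Qed.

(** Doubling the variable turns the integrand of [refl_int (s / 2)] into the one on the shifted
    line. The shift stops halfway to the pole [i PI], so no residue enters. *)
Lemma refl_half (s : R) : 0 < s < 1 -> refl_int (s / 2) = 2 * cos (s * (PI / 2)) * refl_int s.
Proof.
  intros Hs.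
  assert (H := line_int_scale _ _ 2 ltac:(lra) (refl_line_int (s / 2) ltac:(lra))). simpl in H.
  assert (K := line_int_scal _ _ 2 (refl_quarter_turn s Hs)).
  rewrite Rmult_assoc. apply (line_int_unique _ _ _ H). apply line_int_ext with (2 := K).
  intros t. do 2 f_equal. f_equal. field.
Qed.

(** The factor [2 * cos] of [refl_half] is the one in the duplication formula of the sine, so
    [sin (PI * s) * refl_int s] is invariant under halving. *)
Lemma refl_sin_half (s : R) : 0 < s < 1 ->
  sin (PI * (s / 2)) * refl_int (s / 2) = sin (PI * s) * refl_int s.
Proof.
  intros Hs. rewrite refl_half by auto.
  replace (PI * s) with (2 * (PI * (s / 2))) by field. rewrite sin_2a.
  replace (s * (PI / 2)) with (PI * (s / 2)) by field. ring.
Qed.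

(** For small [s] the mass sits on the negative half-line, where the integrand is close to
    [exp (s * v)], of mass [1 / s]. The lower bound uses [1 / (1 + exp v) >= 1 - exp v] there. *)
Lemma refl_small (s : R) : 0 < s <= / 2 -> Rabs (s * refl_int s - 1) <= 2 * s.
Proof.
  intros Hs. pose proof (refl_line_int s ltac:(lra)) as HL.
  assert (Hpos : forall t, 0 <= exp (s * t) / (1 + exp t)).
  { intros t. left. apply Rdiv_lt_0_compat; [apply exp_pos | apply exp_1p_pos]. }
  assert (Hu : refl_int s <= / s + / (1 - s)).
  { destruct (beta_kernel_ex_line_int (1 - s) s ltac:(lra) ltac:(lra)) as [l [Hl Hle]].
    rewrite (line_int_unique _ (refl_int s) l HL); auto.
    apply line_int_ext with (2 := Hl). intros; apply beta_kernel_refl. }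
  assert (Hl : / s - / (s + 1) <= refl_int s).
  { assert (Hlim : is_lim (fun T => (1 - exp (- (s * T))) * / s - (1 - exp (- ((s + 1) * T))) * / (s + 1))
       p_infty ((1 - 0) * / s - (1 - 0) * / (s + 1))).
    { apply is_lim_minus'.
      - apply (is_lim_scal_r _ (/ s) p_infty (1 - 0)).
        apply is_lim_minus'; [apply is_lim_const | apply is_lim_exp_lin; lra].
      - apply (is_lim_scal_r _ (/ (s + 1)) p_infty (1 - 0)).
        apply is_lim_minus'; [apply is_lim_const | apply is_lim_exp_lin; lra]. }
    rewrite Rminus_0_r, !Rmult_1_l in Hlim.
    apply (is_lim_le_const _ _ _ 0 Hlim). intros T HT.
    apply Rle_trans with (RInt (fun v => exp (s * v) / (1 + exp v)) (- T) 0).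
    2: apply RInt_le_line_int; auto; lra.
    apply Rle_trans with (RInt (fun v => exp (s * v) - exp ((s + 1) * v)) (- T) 0).
    - right. symmetry. etransitivity.
      + apply (RInt_minus (fun v => exp (s * v)) (fun v => exp ((s + 1) * v)));
        apply continuous_ex_RInt; intros; cont_tac; auto.
      + rewrite !RInt_exp_lin by lra. unfold minus, plus, opp; simpl.
        rewrite !Rmult_0_r, exp_0, !Ropp_mult_distr_r_reverse. field. lra.
    - apply RInt_le; try lra.
      + apply continuous_ex_RInt. intros; cont_tac; auto.
      + apply continuous_ex_RInt, (line_int_cont _ _ HL).
      + intros x _. rewrite Rmult_plus_distr_r, Rmult_1_l, exp_plus.
        pose proof (exp_pos x). pose proof (exp_pos (s * x)).
        apply Rmult_le_reg_r with (1 + exp x); [lra|]. unfold Rdiv.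
        rewrite Rmult_assoc, Rinv_l by lra.
        replace ((exp (s * x) - exp (s * x) * exp x) * (1 + exp x)) with
          (exp (s * x) - exp (s * x) * (exp x * exp x)) by ring.
        assert (0 < exp (s * x) * (exp x * exp x)) by (repeat apply Rmult_lt_0_compat; auto). lra. }
  apply (Rmult_le_compat_l s) in Hu; [|lra]. apply (Rmult_le_compat_l s) in Hl; [|lra].
  rewrite Rmult_plus_distr_l, Rinv_r in Hu by lra. rewrite Rmult_minus_distr_l, Rinv_r in Hl by lra.
  assert (/ (1 - s) <= 2).
  { rewrite <- (Rinv_inv 2). apply Rinv_le_contravar; lra. }
  assert (/ (s + 1) <= 1).
  { rewrite <- Rinv_1. apply Rinv_le_contravar; lra. }
  assert (s * / (1 - s) <= s * 2) by (apply Rmult_le_compat_l; lra).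
  assert (s * / (s + 1) <= s * 1) by (apply Rmult_le_compat_l; lra).
  apply Rabs_le. lra.
Qed.

(** The halving invariant is followed along [s / 2 ^ n]: it is constant, and its limit is [PI], by
    [sin x / x -> 1] and [refl_small]. *)
Lemma Gamma_reflection (s : R) : 0 < s < 1 -> Gamma (1 - s) * Gamma s * sin (PI * s) = PI.
Proof.
  intros Hs. pose proof PI_RGT_0 as HPI. fold (refl_int s).
  set (sn := fun n : nat => s / 2 ^ n).
  assert (H2 : forall n, 1 <= 2 ^ n) by (intros; apply pow_R1_Rle; lra).
  assert (Hsn : forall n, 0 < sn n < 1).
  { intros n. specialize (H2 n). unfold sn. split; [apply Rdiv_lt_0_compat; lra|].
    apply Rmult_lt_reg_r with (2 ^ n); [lra|]. unfold Rdiv. rewrite Rmult_assoc, Rinv_l by lra. lra. }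
  assert (Hc : forall n, sin (PI * sn n) * refl_int (sn n) = sin (PI * s) * refl_int s).
  { induction n.
    - unfold sn. simpl. now rewrite Rdiv_1_r.
    - replace (sn (S n)) with (sn n / 2) by (unfold sn; simpl; field; apply Rgt_not_eq; specialize (H2 n); lra).
      rewrite refl_sin_half; auto. }
  assert (L0 : is_lim_seq sn 0).
  { replace (Finite 0) with (Rbar_mult s 0) by (simpl; f_equal; ring).
    apply (is_lim_seq_scal_l (fun n => / 2 ^ n) s 0).
    apply is_lim_seq_ext with (fun n => (/ 2) ^ n); [intros; apply pow_inv|].
    apply is_lim_seq_geom. rewrite Rabs_pos_eq; lra. }
  assert (L1 : is_lim_seq (fun n => sin (PI * sn n) / (PI * sn n)) 1).
  { apply (is_lim_comp_seq (fun x => sin x / x) (fun n => PI * sn n) 0 1).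
    - apply is_lim_sinc_0.
    - exists 0%nat. intros n _ E. injection E as E. specialize (Hsn n).
      assert (0 < PI * sn n) by (apply Rmult_lt_0_compat; lra). lra.
    - replace (Finite 0) with (Rbar_mult PI 0) by (simpl; f_equal; ring).
      apply is_lim_seq_scal_l; auto. }
  assert (L2 : is_lim_seq (fun n => sn n * refl_int (sn n)) 1).
  { apply is_lim_seq_spec. intros eps.
    assert (He : 0 < Rmin (/ 2) (eps / 2)) by (apply Rmin_pos; [lra | destruct eps; simpl; lra]).
    apply is_lim_seq_spec in L0. destruct (L0 (mkposreal _ He)) as [N HN].
    exists N. intros n Hn. specialize (HN n Hn). specialize (Hsn n). simpl in HN.
    rewrite Rminus_0_r, Rabs_pos_eq in HN by lra.
    pose proof (Rmin_l (/ 2) (eps / 2)). pose proof (Rmin_r (/ 2) (eps / 2)).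
    eapply Rle_lt_trans; [apply refl_small; lra|]. lra. }
  assert (L3 : is_lim_seq (fun n => sin (PI * sn n) / (PI * sn n) * (sn n * refl_int (sn n))) (1 * 1))
    by (apply is_lim_seq_mult'; auto).
  assert (L4 : is_lim_seq (fun n => sin (PI * sn n) / (PI * sn n) * (sn n * refl_int (sn n)))
     (sin (PI * s) * refl_int s / PI)).
  { apply is_lim_seq_ext with (fun _ => sin (PI * s) * refl_int s / PI); [|apply is_lim_seq_const].
    intros n. rewrite <- (Hc n). specialize (Hsn n). field. lra. }
  apply is_lim_seq_unique in L3. apply is_lim_seq_unique in L4. rewrite L3 in L4.
  injection L4 as E.
  transitivity (sin (PI * s) * refl_int s / PI * PI); [field; lra | rewrite <- E; ring].
Qed.

(** * Hankel's formula for 1 / Gamma *)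

(* Real and imaginary parts of [exp z * z ^ (- s)] at [z = exp (r + i t)]. *)
Definition hankel_re (s r t : R) : R := exp (exp r * cos t - s * r) * cos (exp r * sin t - s * t).
Definition hankel_im (s r t : R) : R := exp (exp r * cos t - s * r) * sin (exp r * sin t - s * t).
(** The circular part of Hankel's contour, of radius [exp r], with [dz = i z dt]; by conjugation the
    upper half suffices. *)
Definition hankel (s r : R) : R := RInt (hankel_re s r) 0 PI.

Lemma continuous_hankel_re (s r t : R) : continuous (hankel_re s r) t.
Proof. unfold hankel_re. cont_tac; auto. Qed.

Lemma hankel_im_0 (s r : R) : hankel_im s r 0 = 0.
Proof. unfold hankel_im. rewrite sin_0, !Rmult_0_r, Rminus_0_r, sin_0. ring. Qed.

Lemma hankel_im_PI (s r : R) : hankel_im s r PI = - sin (s * PI) * gamma_kernel (- s) r.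
Proof.
  unfold hankel_im, gamma_kernel. rewrite sin_PI, cos_PI, Rmult_0_r, Rminus_0_l, sin_neg.
  replace (exp r * -1 - s * r) with (- s * r - exp r) by ring. ring.
Qed.

(** Cauchy's theorem on a half annulus. The function is real on the positive half-line, so only the
    upper side of the cut along the negative half-line contributes. *)
Lemma hankel_shift (s a b : R) :
  hankel s b - hankel s a = - sin (s * PI) * RInt (gamma_kernel (- s)) a b.
Proof.
  pose proof PI_RGT_0. unfold hankel.
  rewrite (contour_shift (hankel_re s) (hankel_im s)
    (fun r t => hankel_re s r t * (exp r * cos t - s) - hankel_im s r t * (exp r * sin t)) (- 1) (PI + 1));
    try lra.
  - rewrite <- RInt_scal_cont by apply continuous_gamma_kernel. apply RInt_ext.
    intros r _. rewrite hankel_im_0, hankel_im_PI. eq_R. ring.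
  - intros r t _. unfold hankel_re, hankel_im. auto_derive; auto. unfold Rminus. ring.
  - intros r t _. unfold hankel_re, hankel_im. auto_derive; auto. unfold Rminus. ring.
  - intros r t _. unfold hankel_re, hankel_im. cont2d.
  - intros; apply continuous_hankel_re.
  - intros r t _. unfold hankel_im. cont_tac; auto.
Qed.

(** The arc form of [Gamma (1 + s) = s * Gamma s]: the [t]-derivative of [hankel_im s] is
    [hankel_re (s - 1) - s * hankel_re s]. *)
Lemma hankel_rec (s r : R) :
  s * hankel s r = hankel (s - 1) r + sin (s * PI) * gamma_kernel (- s) r.
Proof.
  assert (H : RInt (fun t => hankel_re (s - 1) r t - s * hankel_re s r t) 0 PI
    = hankel_im s r PI - hankel_im s r 0).
  { apply is_RInt_unique. apply (is_RInt_derive (hankel_im s r)).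
    - intros t _. unfold hankel_re, hankel_im. auto_derive; auto.
      replace (exp r * cos t - (s - 1) * r) with (r + (exp r * cos t - s * r)) by ring.
      replace (exp r * sin t - (s - 1) * t) with (t + (exp r * sin t - s * t)) by ring.
      rewrite (exp_plus r), (cos_plus t). unfold Rminus. ring.
    - intros t _. unfold hankel_re. cont_tac; auto. }
  rewrite hankel_im_0, hankel_im_PI in H. unfold hankel.
  assert (E : RInt (fun t => hankel_re (s - 1) r t - s * hankel_re s r t) 0 PI =
    RInt (hankel_re (s - 1) r) 0 PI - s * RInt (hankel_re s r) 0 PI).
  { rewrite <- RInt_scal_cont by apply continuous_hankel_re.
    apply (RInt_minus (hankel_re (s - 1) r) (fun t => s * hankel_re s r t));
    apply continuous_ex_RInt; intros; unfold hankel_re; cont_tac; auto. }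
  lra.
Qed.

(** For [s = 0] the cut disappears in [hankel_shift], so the radius is irrelevant and can shrink to
    0, where the integrand becomes 1. *)
Lemma hankel_0 (r : R) : hankel 0 r = PI.
Proof.
  set (f := fun y t => exp (y * cos t) * cos (y * sin t)).
  set (F := fun y => RInt (f y) 0 PI).
  assert (HF : forall u, hankel 0 u = F (exp u)).
  { intros u. apply RInt_ext. intros t _. unfold hankel_re, f. now rewrite !Rmult_0_l, !Rminus_0_r. }
  assert (Hcst : forall u, hankel 0 (- u) = hankel 0 r).
  { intros u. pose proof (hankel_shift 0 r (- u)) as H.
    rewrite Rmult_0_l, sin_0, Ropp_0, Rmult_0_l in H. lra. }
  assert (H0 : F 0 = PI).
  { unfold F. rewrite (RInt_ext _ (fun _ => 1)).
    - rewrite RInt_const. unfold scal; simpl; unfold mult; simpl. ring.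
    - intros t _. unfold f. now rewrite !Rmult_0_l, exp_0, cos_0, Rmult_1_l. }
  assert (Hc : continuous F 0).
  { pose proof PI_RGT_0. apply continuous_RInt_param; [lra| |].
    - intros t. unfold f. cont2d.
    - intros y t. unfold f. cont_tac; auto. }
  assert (L : is_lim (fun u => F (exp (- (1 * u)))) p_infty (F 0)).
  { apply (is_lim_comp F (fun u => exp (- (1 * u))) p_infty (F 0) 0).
    - apply is_lim_continuity, continuity_pt_filterlim. exact Hc.
    - apply is_lim_exp_lin; lra.
    - exists 0. intros y _ E. injection E as E. pose proof (exp_pos (- (1 * y))). lra. }
  assert (L' : is_lim (fun u => F (exp (- (1 * u)))) p_infty (hankel 0 r)).
  { apply is_lim_ext with (fun _ => hankel 0 r); [|apply is_lim_const].
    intros u. rewrite <- HF, Rmult_1_l. symmetry. apply Hcst. }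
  apply is_lim_unique in L. apply is_lim_unique in L'. rewrite L in L'. injection L' as E. lra.
Qed.

(** For [- 1 < s < 0] small arcs vanish, leaving the integral over the whole cut, which the
    reflection formula evaluates. For larger [s] small arcs need not vanish, hence the induction
    through [hankel_rec]. *)
Lemma hankel_lim (s : R) : - 1 < s -> is_lim (hankel s) p_infty (PI / Gamma (1 + s)).
Proof.
  intros Hs0. pose proof PI_RGT_0 as HPI.
  assert (Hind : forall n s, - 1 < s <= INR n -> is_lim (hankel s) p_infty (PI / Gamma (1 + s))).
  { induction n as [|n IH]; intros s0 Hs; simpl INR in Hs.
    - destruct (Req_dec s0 0) as [->|Hn].
      + rewrite Rplus_0_r, Gamma_1, Rdiv_1_r.
        apply is_lim_ext with (fun _ => PI); [|apply is_lim_const]. intros; now rewrite hankel_0.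
      (* From here [s] is the opposite of the exponent, so that it lies in [(0, 1)]. *)
      + clear s Hs0. set (s := - s0). replace s0 with (- s) by (unfold s; ring).
        assert (Hs' : 0 < s < 1) by (unfold s; lra).
        replace (PI / Gamma (1 + - s)) with (0 + sin (s * PI) * Gamma s).
        2: { pose proof (Gamma_reflection s Hs') as Hr. rewrite (Rmult_comm PI) in Hr.
             pose proof (Gamma_pos (1 - s) ltac:(lra)). replace (1 + - s) with (1 - s) by ring.
             transitivity (Gamma (1 - s) * Gamma s * sin (s * PI) / Gamma (1 - s)); [field; lra | now rewrite Hr]. }
        apply is_lim_ext with (fun T => hankel (- s) (- T) + sin (s * PI) * RInt (gamma_kernel s) (- T) T).
        { intros T. pose proof (hankel_shift (- s) (- T) T) as H.
          rewrite Ropp_involutive, (Ropp_mult_distr_l_reverse s PI), sin_neg in H. lra. }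
        apply is_lim_plus'.
        * apply (is_lim_squeeze0 _ (fun T => PI * exp 1 * exp (- (s * T))) _ 0).
          -- intros T HT. unfold hankel. rewrite Rminus_0_r, Rmult_assoc. replace PI with (PI - 0) at 2 by ring.
             apply Rabs_RInt_le_const; [lra|intros; apply continuous_hankel_re|].
             intros t Ht. unfold hankel_re. rewrite Rabs_mult, Rabs_pos_eq by (left; apply exp_pos).
             rewrite <- (Rmult_1_r (exp 1 * exp (- (s * T)))). apply Rmult_le_compat;
               [left; apply exp_pos | apply Rabs_pos | |apply Rabs_le, COS_bound].
             rewrite <- exp_plus. apply exp_le_le. pose proof (COS_bound t) as [_ Hc].
             pose proof (exp_pos (- T)). assert (exp (- T) <= 1) by (rewrite <- exp_0; apply exp_le_le; lra).
             assert (exp (- T) * cos t <= exp (- T) * 1) by (apply Rmult_le_compat_l; lra). lra.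
          -- replace (Finite 0) with (Rbar_mult (PI * exp 1) 0) by (simpl; f_equal; ring).
             apply is_lim_scal_l, is_lim_exp_lin. lra.
        * apply (is_lim_scal_l _ (sin (s * PI)) p_infty (Gamma s)). apply Gamma_line_int; lra.
    - destruct (Rle_dec s0 0) as [Hle|Hgt].
      + apply IH. split; [lra|]. pose proof (pos_INR n). lra.
      + assert (H1 : - 1 < s0 - 1 <= INR n) by (destruct n; simpl in *; lra).
        specialize (IH _ H1). replace (1 + (s0 - 1)) with s0 in IH by ring.
        rewrite Gamma_succ by lra. pose proof (Gamma_pos s0 ltac:(lra)).
        replace (PI / (s0 * Gamma s0)) with (/ s0 * (PI / Gamma s0 + sin (s0 * PI) * 0)) by (field; lra).
        apply is_lim_ext with (fun r => / s0 * (hankel (s0 - 1) r + sin (s0 * PI) * gamma_kernel (- s0) r)).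
        { intros r. rewrite <- hankel_rec. field. lra. }
        apply (is_lim_scal_l _ (/ s0) p_infty (PI / Gamma s0 + sin (s0 * PI) * 0)).
        apply is_lim_plus'; auto.
        apply (is_lim_scal_l _ (sin (s0 * PI)) p_infty 0). apply gamma_kernel_lim_p. }
  destruct (nfloor_ex (Rabs s) (Rabs_pos s)) as [n Hn].
  apply (Hind (S n)). rewrite S_INR. pose proof (Rle_abs s). lra.
Qed.

Lemma is_lim_dist_le (f : R -> R) (c l M T0 : R) :
  is_lim f p_infty l -> (forall T, T0 < T -> Rabs (c - f T) <= M) -> Rabs (c - l) <= M.
Proof.
  intros Hl H. apply Rabs_le. split.
  - apply Rplus_le_reg_r with (l + M). replace (c - l + (l + M)) with (c + M) by ring.
    replace (- M + (l + M)) with l by ring.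
    apply (is_lim_le_const _ _ _ T0 Hl). intros T HT. specialize (H T HT).
    apply Rabs_le_between in H. lra.
  - assert (c - M <= l); [|lra].
    apply (is_lim_ge_const _ _ _ T0 Hl). intros T HT. specialize (H T HT).
    apply Rabs_le_between in H. lra.
Qed.

(** The error is the part of the cut beyond radius [exp r], bounded with [exp u >= 1 + u]. There is
    no constant depending on [s], so at [s = n a] the errors form a geometric sequence. *)
Lemma hankel_bound (s r : R) : 0 <= s ->
  Rabs (hankel s r - PI / Gamma (1 + s)) <= exp (- ((s + 1) * r)).
Proof.
  intros Hs.
  apply (is_lim_dist_le (hankel s) _ _ _ r); [apply hankel_lim; lra|]. intros b Hb.
  rewrite Rabs_minus_sym, hankel_shift, Rabs_mult, Rabs_Ropp.
  rewrite (Rabs_pos_eq (RInt _ _ _)).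
  2: { apply RInt_ge_0; [lra| |intros; left; apply gamma_kernel_pos].
       apply continuous_ex_RInt, continuous_gamma_kernel. }
  assert (H1 : Rabs (sin (s * PI)) <= 1) by apply Rabs_le, SIN_bound.
  assert (H2 : RInt (gamma_kernel (- s)) r b <= exp (- ((s + 1) * r))).
  { apply Rle_trans with (RInt (fun u => exp (- (s + 1) * u)) r b).
    - apply RInt_le; [lra|apply continuous_ex_RInt, continuous_gamma_kernel| |].
      + apply continuous_ex_RInt. intros; cont_tac; auto.
      + intros u _. apply exp_le_le. pose proof (exp_ineq1_le u). lra.
    - rewrite RInt_exp_lin by lra.
      replace ((exp (- (s + 1) * b) - exp (- (s + 1) * r)) / - (s + 1)) with
        ((exp (- (s + 1) * r) - exp (- (s + 1) * b)) * / (s + 1)) by (field; lra).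
      pose proof (exp_pos (- (s + 1) * b)).
      assert (exp (- (s + 1) * b) <= exp (- (s + 1) * r)).
      { apply exp_le_le. assert ((s + 1) * r <= (s + 1) * b) by (apply Rmult_le_compat_l; lra). lra. }
      assert (/ (s + 1) <= 1) by (rewrite <- Rinv_1; apply Rinv_le_contravar; lra).
      replace (- ((s + 1) * r)) with (- (s + 1) * r) by ring.
      apply Rle_trans with ((exp (- (s + 1) * r) - exp (- (s + 1) * b)) * 1); [|lra].
      apply Rmult_le_compat_l; lra. }
  rewrite <- (Rmult_1_l (exp _)). apply Rmult_le_compat; auto; [apply Rabs_pos|].
  apply RInt_ge_0; [lra| |intros; left; apply gamma_kernel_pos].
  apply continuous_ex_RInt, continuous_gamma_kernel.
Qed.

(** * The Mittag-Leffler power series *)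

Definition ml_coef (a : R) (n : nat) : R := / Gamma (1 + INR n * a).

Lemma ml_CV_radius (a z : R) : 0 < a -> Rbar_lt (Rabs z) (CV_radius (ml_coef a)).
Proof.
  intros Ha. apply Rbar_lt_le_trans with (Rabs z + 1); [simpl; lra|].
  destruct (CV_radius_bounded (ml_coef a)) as [Hub _]. apply Hub.
  (* This [k] gives [exp (a * k) = Rabs z + 1], so [Gamma_lower] at [s = n a] bounds the n-th term
     at [Rabs z + 1]. *)
  set (k := ln (Rabs z + 1) / a). exists (exp (exp k)). intros n.
  assert (Hn : 0 <= INR n * a) by (apply Rmult_le_pos; [apply pos_INR | lra]).
  pose proof (Rabs_pos z) as Hz.
  assert (Hp : (Rabs z + 1) ^ n = exp (INR n * a * k)).
  { rewrite <- Rpower_pow by lra. unfold Rpower, k. f_equal. field. lra. }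
  pose proof (Gamma_lower (INR n * a) k Hn) as Hl. rewrite <- Hp in Hl.
  assert (Hg : 0 < Gamma (1 + INR n * a)) by (apply Gamma_pos; lra).
  assert (Hpp : 0 < (Rabs z + 1) ^ n) by (apply pow_lt; lra).
  unfold ml_coef. rewrite Rabs_pos_eq by (left; apply Rmult_lt_0_compat; auto; apply Rinv_0_lt_compat; auto).
  apply Rmult_le_reg_l with (Gamma (1 + INR n * a)); auto.
  rewrite <- Rmult_assoc, Rinv_r, Rmult_1_l by lra.
  apply Rmult_le_reg_r with (exp (- exp k)); [apply exp_pos|].
  rewrite Rmult_assoc, <- exp_plus. replace (exp k + - exp k) with 0 by ring.
  rewrite exp_0. lra.
Qed.

Lemma ML_PSeries (a z : R) : ML a z = PSeries (ml_coef a) z.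
Proof. apply Series_ext. intros n. unfold ml_coef, Rdiv. ring. Qed.

(** * The spectral density *)

Lemma cos2_sin2 (u : R) : cos u * cos u + sin u * sin u = 1.
Proof. pose proof (sin2_cos2 u). unfold Rsqr in *. lra. Qed.

(* Real part of [exp (x z) * z ^ (- s) / (1 + z ^ (- a))] at [z = exp (r + i t)]. *)
Definition spec_re (a x s r t : R) : R :=
  exp (x * (exp r * cos t) - s * r) *
  ((cos (x * (exp r * sin t) - s * t) * (1 + exp (- a * r) * cos (a * t))
    + - sin (x * (exp r * sin t) - s * t) * (exp (- a * r) * sin (a * t)))
   / ((1 + exp (- a * r) * cos (a * t)) * (1 + exp (- a * r) * cos (a * t))
    + exp (- a * r) * sin (a * t) * (exp (- a * r) * sin (a * t)))).

(** The companion imaginary part, only for [s = 0]: the contour is moved for that exponent alone. *)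
Definition spec_im (a x r t : R) : R :=
  exp (x * (exp r * cos t)) *
  ((sin (x * (exp r * sin t)) * (1 + exp (- a * r) * cos (a * t))
    + cos (x * (exp r * sin t)) * (exp (- a * r) * sin (a * t)))
   / ((1 + exp (- a * r) * cos (a * t)) * (1 + exp (- a * r) * cos (a * t))
    + exp (- a * r) * sin (a * t) * (exp (- a * r) * sin (a * t)))).

(* [spec_im a x r PI = PI * exp (- x e^r) * spec a r] *)
Definition spec (a r : R) : R :=
  sin (a * PI) / PI / (exp (a * r) + 2 * cos (a * PI) + exp (- a * r)).

Lemma spec_norm_pos (a r t : R) : 0 < a -> - PI / a < t < PI / a ->
  0 < (1 + exp (- a * r) * cos (a * t)) * (1 + exp (- a * r) * cos (a * t))
    + exp (- a * r) * sin (a * t) * (exp (- a * r) * sin (a * t)).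
Proof.
  intros Ha [H1 H2]. apply norm_1p_polar_pos; [apply exp_pos|].
  apply (Rmult_lt_compat_l a) in H1; auto. apply (Rmult_lt_compat_l a) in H2; auto.
  replace (a * (- PI / a)) with (- PI) in H1 by (field; lra).
  replace (a * (PI / a)) with PI in H2 by (field; lra). auto.
Qed.

(** The zeros of [1 + z ^ (- a)] nearest to the positive axis have arguments [PI / a] and
    [- PI / a]; for [a < 1] the deformation onto the cut meets none. *)
Lemma spec_range (a t : R) : 0 < a < 1 -> 0 <= t <= PI -> - PI / a < t < PI / a.
Proof.
  intros Ha Ht. pose proof PI_RGT_0. assert (PI < PI / a).
  { apply Rmult_lt_reg_r with a; [lra|]. unfold Rdiv. rewrite Rmult_assoc, Rinv_l by lra.
    apply Rmult_lt_compat_l; lra. }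
  unfold Rdiv in *. rewrite Ropp_mult_distr_l_reverse. lra.
Qed.

Lemma continuous_spec_re (a x s r t : R) : 0 < a -> - PI / a < t < PI / a ->
  continuous (spec_re a x s r) t.
Proof.
  intros Ha Ht. pose proof (spec_norm_pos a r t Ha Ht). unfold spec_re. cont_tac. lra.
Qed.

(** This is [exp (a * r)] times the squared modulus of [1 + z ^ (- a)] on the cut. *)
Lemma spec_den_pos (a r : R) : 0 < a < 1 -> 0 < exp (a * r) + 2 * cos (a * PI) + exp (- a * r).
Proof.
  intros Ha. pose proof PI_RGT_0.
  pose proof (spec_norm_pos a r PI ltac:(lra) (spec_range a PI Ha ltac:(lra))) as H1.
  pose proof (exp_pos (a * r)) as He.
  assert (E : exp (a * r) * exp (- a * r) = 1) by (rewrite <- exp_plus, <- exp_0; f_equal; ring).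
  apply Rmult_lt_compat_l with (r := exp (a * r)) in H1; auto. rewrite Rmult_0_r in H1.
  eapply Rlt_le_trans; [exact H1|]. right.
  transitivity (exp (a * r) + 2 * cos (a * PI) * (exp (a * r) * exp (- a * r)) + exp (a * r) * exp (- a * r) *
    exp (- a * r) * (cos (a * PI) * cos (a * PI) + sin (a * PI) * sin (a * PI))); [ring|].
  rewrite E, cos2_sin2. ring.
Qed.

Lemma continuous_spec (a r : R) : 0 < a < 1 -> continuous (spec a) r.
Proof.
  intros Ha. pose proof (spec_den_pos a r Ha). unfold spec. cont_tac. lra.
Qed.

Lemma spec_pos (a r : R) : 0 < a < 1 -> 0 < spec a r.
Proof.
  intros Ha. pose proof PI_RGT_0. unfold spec. apply Rdiv_lt_0_compat; [|apply spec_den_pos; auto].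
  apply Rdiv_lt_0_compat; auto. apply sin_gt_0; [apply Rmult_lt_0_compat; lra|].
  rewrite <- (Rmult_1_l PI) at 2. apply Rmult_lt_compat_r; lra.
Qed.

Lemma spec_contour (a x T1 T2 : R) : 0 < a < 1 ->
  RInt (spec_re a x 0 T2) 0 PI - RInt (spec_re a x 0 T1) 0 PI =
  RInt (fun r => PI * (exp (- (x * exp r)) * spec a r)) T1 T2.
Proof.
  intros Ha. pose proof PI_RGT_0 as HPI.
  assert (H0 : - PI / a < 0 < PI / a) by (apply spec_range; lra).
  assert (H1 : - PI / a < PI < PI / a) by (apply spec_range; lra).
  (* The derivative supplied is the real part of the function times its logarithmic derivative
     [x z + a z ^ (- a) / (1 + z ^ (- a))], where [z ^ (- a) = X - i Y] and [A = 1 + X]. *)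
  rewrite (contour_shift (spec_re a x 0) (spec_im a x) (fun r t =>
     let A := 1 + exp (- a * r) * cos (a * t) in
     let X := exp (- a * r) * cos (a * t) in
     let Y := exp (- a * r) * sin (a * t) in
     spec_re a x 0 r t * (x * (exp r * cos t) + a * (X * A + Y * Y) * / (A * A + Y * Y))
     - spec_im a x r t * (x * (exp r * sin t) + a * (X * Y - Y * A) * / (A * A + Y * Y)))
     (- PI / a) (PI / a)); try lra.
  - apply RInt_ext. intros r _. eq_R. unfold spec_im, spec.
    pose proof (spec_norm_pos a r PI ltac:(lra) H1) as D1.
    pose proof (spec_den_pos a r Ha) as D2.
    rewrite sin_PI, cos_PI, sin_0, cos_0, !Rmult_0_r, sin_0, cos_0.
    pose proof (exp_pos (- a * r)) as He.
    assert (E : exp (a * r) = / exp (- a * r)).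
    { rewrite <- exp_Ropp. f_equal. ring. }
    rewrite E in *.
    replace (x * (exp r * -1)) with (- (x * exp r)) by ring.
    assert (D3 : (1 + exp (- a * r) * cos (a * PI)) * (1 + exp (- a * r) * cos (a * PI)) +
        exp (- a * r) * sin (a * PI) * (exp (- a * r) * sin (a * PI))
        = exp (- a * r) * (/ exp (- a * r) + 2 * cos (a * PI) + exp (- a * r))).
    { transitivity (1 + 2 * exp (- a * r) * cos (a * PI) + exp (- a * r) * exp (- a * r) *
        (cos (a * PI) * cos (a * PI) + sin (a * PI) * sin (a * PI))); [ring|].
      rewrite cos2_sin2. field. lra. }
    rewrite D3. set (D := / exp (- a * r) + 2 * cos (a * PI) + exp (- a * r)) in *.
    field. lra.
  - intros r t Ht. pose proof (spec_norm_pos a r t ltac:(lra) Ht) as D.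
    cbv zeta. unfold spec_re, spec_im. auto_derive; [lra|].
    unfold Rminus. rewrite !Rmult_0_l, !Ropp_0, !Rplus_0_r. field. lra.
  - intros r t Ht. pose proof (spec_norm_pos a r t ltac:(lra) Ht) as D.
    cbv zeta. unfold spec_re, spec_im. auto_derive; [lra|].
    unfold Rminus. rewrite !Rmult_0_l, !Ropp_0, !Rplus_0_r. field. lra.
  - intros r t Ht. pose proof (spec_norm_pos a r t ltac:(lra) Ht) as D.
    cbv zeta. unfold spec_re, spec_im, Rdiv. cont2d; lra.
  - intros r t Ht. apply continuous_spec_re; lra.
  - intros r t Ht. pose proof (spec_norm_pos a r t ltac:(lra) Ht) as D.
    unfold spec_im. cont_tac. lra.
Qed.

(** Reverse triangle inequality for [1 + z ^ (- a)]. *)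
Lemma spec_re_bound (a x s r t d : R) : 0 <= x -> 0 < d -> d <= Rabs (1 - exp (- a * r)) ->
  Rabs (spec_re a x s r t) <= exp (x * exp r - s * r) * / d.
Proof.
  intros Hx Hd Hm. unfold spec_re. rewrite Rabs_mult, (Rabs_pos_eq (exp _)) by (left; apply exp_pos).
  apply Rmult_le_compat; [left; apply exp_pos | apply Rabs_pos | |].
  - apply exp_le_le. pose proof (COS_bound t) as [_ Hc]. pose proof (exp_pos r).
    assert (x * (exp r * cos t) <= x * (exp r * 1)) by (repeat apply Rmult_le_compat_l; lra). lra.
  - apply Rabs_quot_le; auto.
    + rewrite <- (cos2_sin2 (x * (exp r * sin t) - s * t)). ring.
    + set (m := exp (- a * r)) in *.
      replace ((1 + m * cos (a * t)) * (1 + m * cos (a * t)) + m * sin (a * t) * (m * sin (a * t)))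
        with (1 + 2 * m * cos (a * t) + m * m * (cos (a * t) * cos (a * t) + sin (a * t) * sin (a * t))) by ring.
      rewrite cos2_sin2.
      assert (d * d <= (1 - m) * (1 - m)).
      { replace ((1 - m) * (1 - m)) with (Rabs (1 - m) * Rabs (1 - m)).
        - apply Rmult_le_compat; lra.
        - rewrite <- Rabs_mult. apply Rabs_pos_eq, Rle_0_sqr. }
      assert (0 < m) by apply exp_pos. pose proof (COS_bound (a * t)) as [Hc _].
      assert (m * -1 <= m * cos (a * t)) by (apply Rmult_le_compat_l; lra). lra.
Qed.

Lemma spec_re_small (a x : R) : 0 < a < 1 -> 0 <= x ->
  is_lim (fun T => RInt (spec_re a x 0 (- T)) 0 PI) p_infty 0.
Proof.
  intros Ha Hx. pose proof PI_RGT_0.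
  (* Past [ln 2 / a] one has [exp (a * T) > 2], so the denominator has modulus at least
     [exp (a * T) / 2]. *)
  apply (is_lim_squeeze0 _ (fun T => PI * (exp x * 2) * exp (- (a * T))) _ (ln 2 / a)).
  - intros T HT. assert (Hl2 : 0 < ln 2 / a).
    { apply Rdiv_lt_0_compat; [|lra]. rewrite <- ln_1. apply ln_increasing; lra. }
    rewrite Rminus_0_r, !Rmult_assoc. replace PI with (PI - 0) at 2 by ring.
    apply Rabs_RInt_le_const; [lra| |].
    + intros t Ht. apply continuous_spec_re; [lra|]. apply spec_range; auto.
    + intros t Ht.
      assert (Hm : 2 < exp (- a * - T)).
      { rewrite <- (exp_ln 2) at 1 by lra. apply exp_increasing.
        apply (Rmult_lt_compat_l a) in HT; [|lra].
        replace (a * (ln 2 / a)) with (ln 2) in HT by (field; lra). lra. }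
      eapply Rle_trans; [apply (spec_re_bound _ _ _ _ _ (exp (- a * - T) / 2)); auto; try lra|].
      { rewrite Rabs_left; lra. }
      replace (/ (exp (- a * - T) / 2)) with (2 * exp (- (a * T))).
      2: { replace (- a * - T) with (a * T) by ring. rewrite exp_Ropp. field.
           apply Rgt_not_eq, exp_pos. }
      apply Rmult_le_compat_r; [left; apply Rmult_lt_0_compat; [lra|apply exp_pos]|]. apply exp_le_le.
      assert (exp (- T) <= 1) by (rewrite <- exp_0; apply exp_le_le; lra).
      pose proof (Rmult_le_compat_l x _ _ Hx H0). lra.
  - replace (Finite 0) with (Rbar_mult (PI * (exp x * 2)) 0) by (simpl; f_equal; ring).
    apply is_lim_scal_l, is_lim_exp_lin. lra.
Qed.

(** One step of the geometric series: [1 / (1 + w) = 1 - w / (1 + w)] with [w = z ^ (- a)]. *)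
Lemma spec_re_step (a x s r t : R) : 0 < a < 1 -> 0 <= t <= PI ->
  spec_re a x s r t = exp (x * (exp r * cos t) - s * r) * cos (x * (exp r * sin t) - s * t)
     - spec_re a x (s + a) r t.
Proof.
  intros Ha Ht. pose proof (spec_norm_pos a r t ltac:(lra) (spec_range a t Ha Ht)) as D.
  unfold spec_re.
  replace (x * (exp r * cos t) - (s + a) * r) with ((x * (exp r * cos t) - s * r) + - a * r) by ring.
  replace (x * (exp r * sin t) - (s + a) * t) with ((x * (exp r * sin t) - s * t) - a * t) by ring.
  set (Y := x * (exp r * sin t) - s * t). rewrite (cos_minus Y), (sin_minus Y).
  rewrite (exp_plus (x * (exp r * cos t) - s * r)). field. lra.
Qed.

Lemma is_lim_seq_dist_le (f g : nat -> R) (c l M : R) :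
  is_lim_seq f l -> is_lim_seq g 0 -> (forall n, Rabs (c - f n) <= M + g n) -> Rabs (c - l) <= M.
Proof.
  intros Hf Hg H.
  assert (H1 : is_lim_seq (fun n => M + g n - (c - f n)) (M + 0 - (c - l))).
  { apply is_lim_seq_minus'; [apply is_lim_seq_plus'; auto; apply is_lim_seq_const|].
    apply is_lim_seq_minus'; auto. apply is_lim_seq_const. }
  assert (H2 : is_lim_seq (fun n => M + g n + (c - f n)) (M + 0 + (c - l))).
  { apply is_lim_seq_plus'; [apply is_lim_seq_plus'; auto; apply is_lim_seq_const|].
    apply is_lim_seq_minus'; auto. apply is_lim_seq_const. }
  assert (K1 : Rbar_le 0 (M + 0 - (c - l))).
  { apply (is_lim_seq_le (fun _ => 0) (fun n => M + g n - (c - f n)) 0); auto; [|apply is_lim_seq_const].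
    intros n. specialize (H n). apply Rabs_le_between in H. lra. }
  assert (K2 : Rbar_le 0 (M + 0 + (c - l))).
  { apply (is_lim_seq_le (fun _ => 0) (fun n => M + g n + (c - f n)) 0); auto; [|apply is_lim_seq_const].
    intros n. specialize (H n). apply Rabs_le_between in H. lra. }
  simpl in K1, K2. apply Rabs_le. lra.
Qed.

(** The sharper [2 - m ^ N] in place of 2 is what the induction needs: [m <= / 2] gives
    [2 * m ^ (N + 1) <= m ^ N]. *)
Lemma sum_n_geom_bound (u v : nat -> R) (K m : R) (N : nat) :
  0 <= K -> 0 < m <= / 2 -> (forall n, Rabs (u n - v n) <= K * m ^ n) ->
  Rabs (sum_n u N - sum_n v N) <= K * (2 - m ^ N).
Proof.
  intros HK Hm H. induction N as [|N IH].
  - rewrite !sum_O. specialize (H 0%nat). simpl in *. lra.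
  - rewrite !sum_Sn. unfold plus; simpl.
    specialize (H (S N)). simpl in H.
    replace (sum_n u N + u (S N) - (sum_n v N + v (S N))) with
      ((sum_n u N - sum_n v N) + (u (S N) - v (S N))) by ring.
    eapply Rle_trans; [apply Rabs_triang|].
    assert (Hp : 0 < m ^ N) by (apply pow_lt; lra).
    assert (m * m ^ N <= / 2 * m ^ N) by (apply Rmult_le_compat_r; lra).
    assert (K * (2 - m ^ N) + K * (m * m ^ N) <= K * (2 - m * m ^ N)); [|lra].
    rewrite <- Rmult_plus_distr_l. apply Rmult_le_compat_l; lra.
Qed.

Lemma pow_exp (r : R) (n : nat) : exp r ^ n = exp (INR n * r).
Proof.
  rewrite <- Rpower_pow by apply exp_pos. unfold Rpower. now rewrite ln_exp.
Qed.

(** The half arc of radius [exp r] for [exp (x z) * z ^ (- s)]; rescaling [z] by [x] reduces it to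
    [hankel]. *)
Definition ray_re (x s r : R) : R :=
  RInt (fun t => exp (x * (exp r * cos t) - s * r) * cos (x * (exp r * sin t) - s * t)) 0 PI.

Lemma ray_re_hankel (x s r : R) : 0 < x -> ray_re x s r = exp (s * ln x) * hankel s (r + ln x).
Proof.
  intros Hx. unfold ray_re, hankel. rewrite <- RInt_scal_cont by (intros; apply continuous_hankel_re).
  apply RInt_ext. intros t _. eq_R. unfold hankel_re.
  assert (E : exp (r + ln x) = x * exp r) by (rewrite exp_plus, exp_ln by auto; ring).
  rewrite E, <- (Rmult_assoc (exp (s * ln x))), <- (exp_plus (s * ln x)). f_equal; f_equal; ring.
Qed.

Lemma RInt_spec_re_step (a x s r : R) : 0 < a < 1 ->
  RInt (spec_re a x s r) 0 PI = ray_re x s r - RInt (spec_re a x (s + a) r) 0 PI.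
Proof.
  intros Ha. pose proof PI_RGT_0 as HPI. unfold ray_re.
  rewrite (RInt_ext _ (fun t => exp (x * (exp r * cos t) - s * r) * cos (x * (exp r * sin t) - s * t)
     - spec_re a x (s + a) r t)).
  2: { intros t Ht. rewrite Rmin_left, Rmax_right in Ht by lra. apply spec_re_step; lra. }
  apply (RInt_minus (fun t => exp (x * (exp r * cos t) - s * r) * cos (x * (exp r * sin t) - s * t))
     (spec_re a x (s + a) r)).
  - apply continuous_ex_RInt. intros; cont_tac; auto.
  - apply (ex_RInt_continuous (V := R_CompleteNormedModule)). intros t Ht.
    rewrite Rmin_left, Rmax_right in Ht by lra. apply continuous_spec_re; [lra|].
    apply spec_range; auto.
Qed.

Lemma RInt_spec_re_expand (a x r : R) (N : nat) : 0 < a < 1 ->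
  RInt (spec_re a x 0 r) 0 PI = sum_n (fun n => (-1) ^ n * ray_re x (INR n * a) r) N
    + (-1) ^ S N * RInt (spec_re a x (INR (S N) * a) r) 0 PI.
Proof.
  intros Ha. induction N as [|N IH].
  - rewrite sum_O, RInt_spec_re_step by auto. simpl.
    rewrite Rmult_0_l, Rplus_0_l, !Rmult_1_l. eq_R. ring.
  - rewrite IH, sum_Sn, RInt_spec_re_step by auto. change plus with Rplus.
    replace (INR (S N) * a + a) with (INR (S (S N)) * a) by (rewrite (S_INR (S N)); ring).
    simpl pow. eq_R. ring.
Qed.

Lemma RInt_spec_re_bound (a x s r : R) : 0 < a < 1 -> 0 <= x -> ln 2 / a < r ->
  Rabs (RInt (spec_re a x s r) 0 PI) <= PI * (exp (x * exp r - s * r) * 2).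
Proof.
  intros Ha Hx Hr. pose proof PI_RGT_0. replace PI with (PI - 0) at 2 by ring.
  apply Rabs_RInt_le_const; [lra| |].
  - intros t Ht. apply continuous_spec_re; [lra|]. apply spec_range; auto.
  - intros t Ht. replace 2 with (/ / 2) by field. apply spec_re_bound; auto; [lra|].
    assert (exp (- a * r) < / 2).
    { rewrite <- (exp_ln (/ 2)), ln_Rinv by lra. apply exp_increasing.
      apply (Rmult_lt_compat_l a) in Hr; [|lra].
      replace (a * (ln 2 / a)) with (ln 2) in Hr by (field; lra). lra. }
    rewrite Rabs_pos_eq; lra.
Qed.

Lemma is_series_ML (a z : R) : 0 < a -> is_series (fun n => ml_coef a n * z ^ n) (ML a z).
Proof.
  intros Ha. rewrite ML_PSeries.
  exact (proj1 (is_pseries_R (ml_coef a) z (PSeries (ml_coef a) z))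
    (PSeries_correct (ml_coef a) z (CV_radius_inside (ml_coef a) z (ml_CV_radius a z Ha)))).
Qed.

(** The arc is expanded geometrically and compared termwise with [PI] times the series. In the n-th
    error from [hankel_bound] the powers [x ^ (n a)] cancel, leaving a multiple of [m ^ n] with
    [m <= / 2]; the factor 2 is the sum of that geometric series. The remainder of the expansion
    vanishes as [N] grows at fixed [r]. *)
Lemma RInt_spec_re_ML (a x r : R) : 0 < a < 1 -> 0 < x -> ln 2 / a < r ->
  Rabs (RInt (spec_re a x 0 r) 0 PI - PI * ML a (- Rpower x a)) <= exp (- (r + ln x)) * 2.
Proof.
  intros Ha Hx Hr. pose proof PI_RGT_0 as HPI.
  set (m := exp (- a * r)).
  assert (Hm : 0 < m <= / 2).
  { split; [apply exp_pos|]. unfold m. rewrite <- (exp_ln (/ 2)), ln_Rinv by lra. apply exp_le_le.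
    apply (Rmult_lt_compat_l a) in Hr; [|lra].
    replace (a * (ln 2 / a)) with (ln 2) in Hr by (field; lra). lra. }
  set (v := fun n => PI * (ml_coef a n * (- Rpower x a) ^ n)).
  set (u := fun n => (-1) ^ n * ray_re x (INR n * a) r).
  assert (Hv : is_lim_seq (sum_n v) (PI * ML a (- Rpower x a))).
  { apply (is_series_scal PI (fun n => ml_coef a n * (- Rpower x a) ^ n)). apply is_series_ML; lra. }
  assert (Huv : forall n, Rabs (u n - v n) <= exp (- (r + ln x)) * m ^ n).
  { intros n. unfold u, v. rewrite ray_re_hankel by auto.
    replace (- Rpower x a) with (-1 * Rpower x a) by ring.
    rewrite Rpow_mult_distr. unfold Rpower at 1. rewrite pow_exp.
    replace (INR n * (a * ln x)) with (INR n * a * ln x) by ring. unfold ml_coef.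
    assert (Hna : 0 <= INR n * a) by (apply Rmult_le_pos; [apply pos_INR | lra]).
    set (s := INR n * a) in *.
    replace ((-1) ^ n * (exp (s * ln x) * hankel s (r + ln x)) - PI * (/ Gamma (1 + s) * ((-1) ^ n * exp (s * ln x))))
      with ((-1) ^ n * (exp (s * ln x) * (hankel s (r + ln x) - PI / Gamma (1 + s)))) by (unfold Rdiv; ring).
    rewrite !Rabs_mult, pow_1_abs, Rmult_1_l.
    rewrite (Rabs_pos_eq (exp _)) by (left; apply exp_pos).
    eapply Rle_trans; [apply Rmult_le_compat_l; [left; apply exp_pos | apply hankel_bound; auto]|].
    right. unfold m. rewrite pow_exp, <- !exp_plus. f_equal. unfold s. ring. }
  apply (is_lim_seq_dist_le (sum_n v) (fun n => PI * (exp (x * exp r) * m * 2) * m ^ n) _ _ _ Hv).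
  - replace (Finite 0) with (Rbar_mult (PI * (exp (x * exp r) * m * 2)) 0) by (simpl; f_equal; ring).
    apply is_lim_seq_scal_l, is_lim_seq_geom. rewrite Rabs_pos_eq; lra.
  - intros N. rewrite (RInt_spec_re_expand a x r N Ha). fold u.
    replace (sum_n u N + (-1) ^ S N * RInt (spec_re a x (INR (S N) * a) r) 0 PI - sum_n v N) with
      ((sum_n u N - sum_n v N) + (-1) ^ S N * RInt (spec_re a x (INR (S N) * a) r) 0 PI) by ring.
    eapply Rle_trans; [apply Rabs_triang|]. apply Rplus_le_compat.
    + eapply Rle_trans; [apply (sum_n_geom_bound u v (exp (- (r + ln x))) m); auto; left; apply exp_pos|].
      apply Rmult_le_compat_l; [left; apply exp_pos|]. assert (0 < m ^ N) by (apply pow_lt; lra). lra.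
    + rewrite Rabs_mult, pow_1_abs, Rmult_1_l.
      eapply Rle_trans; [apply RInt_spec_re_bound; auto; lra|]. right.
      replace (x * exp r - INR (S N) * a * r) with (x * exp r + INR (S N) * (- a * r)) by ring.
      rewrite exp_plus, <- pow_exp. fold m. simpl. ring.
Qed.

Lemma spec_line_int_aux (a x l : R) : 0 < a < 1 -> 0 <= x ->
  is_lim (fun T => RInt (spec_re a x 0 T) 0 PI) p_infty (PI * l) ->
  line_int (fun r => exp (- (x * exp r)) * spec a r) l.
Proof.
  intros Ha Hx Hl. pose proof PI_RGT_0 as HPI.
  assert (Hc : forall r, continuous (fun r => PI * (exp (- (x * exp r)) * spec a r)) r).
  { intros r. apply (continuous_scal_r PI (fun r => exp (- (x * exp r)) * spec a r)).
    apply (continuous_mult (fun r => exp (- (x * exp r))) (spec a)).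
    - cont_tac; auto.
    - apply continuous_spec; auto. }
  assert (H : line_int (fun r => PI * (exp (- (x * exp r)) * spec a r)) (PI * l)).
  { split; auto. replace (PI * l) with (PI * l - 0) by ring.
    apply is_lim_ext with (fun T => RInt (spec_re a x 0 T) 0 PI - RInt (spec_re a x 0 (- T)) 0 PI).
    - intros T. apply spec_contour; auto.
    - apply is_lim_minus'; auto. apply spec_re_small; auto. }
  apply (line_int_scal _ _ (/ PI)) in H.
  replace l with (/ PI * (PI * l)) by (field; lra).
  apply line_int_ext with (2 := H). intros t. field. lra.
Qed.

Lemma is_lim_scal_0 (f : R -> R) (c : R) : is_lim f p_infty 0 -> is_lim (fun T => c * f T) p_infty 0.
Proof.
  intros H. replace (Finite 0) with (Rbar_mult c 0) by (simpl; f_equal; ring).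
  apply is_lim_scal_l; auto.
Qed.

Lemma spec_line_int (a x : R) : 0 < a < 1 -> 0 < x ->
  line_int (fun r => exp (- (x * exp r)) * spec a r) (ML a (- Rpower x a)).
Proof.
  intros Ha Hx. apply spec_line_int_aux; auto; [lra|].
  apply (is_lim_squeeze0 _ (fun T => exp (- ln x) * 2 * exp (- (1 * T))) _ (ln 2 / a)).
  - intros T HT. eapply Rle_trans; [apply RInt_spec_re_ML; auto|]. right.
    replace (- (T + ln x)) with (- ln x + - (1 * T)) by ring. rewrite exp_plus. ring.
  - apply is_lim_scal_0, is_lim_exp_lin. lra.
Qed.

(** At [x = 0] a single geometric step suffices: the leading term integrates 1 over the arc and the
    rest decays like [exp (- a T)]. *)
Lemma spec_line_int_1 (a : R) : 0 < a < 1 -> line_int (spec a) 1.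
Proof.
  intros Ha. pose proof PI_RGT_0 as HPI.
  apply line_int_ext with (fun r => exp (- (0 * exp r)) * spec a r).
  { intros r. rewrite Rmult_0_l, Ropp_0, exp_0. ring. }
  apply spec_line_int_aux; auto; [lra|]. rewrite Rmult_1_r.
  apply (is_lim_squeeze0 _ (fun T => PI * 2 * exp (- (a * T))) _ (ln 2 / a)).
  - intros T HT. rewrite RInt_spec_re_step by auto.
    assert (E : ray_re 0 0 T = PI).
    { unfold ray_re. rewrite (RInt_ext _ (fun _ => 1)).
      - rewrite RInt_const. unfold scal; simpl; unfold mult; simpl. ring.
      - intros t _. rewrite !Rmult_0_l, Rminus_diag, exp_0, cos_0. apply Rmult_1_l. }
    rewrite E. replace (PI - RInt (spec_re a 0 (0 + a) T) 0 PI - PI) with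
      (- RInt (spec_re a 0 (0 + a) T) 0 PI) by ring. rewrite Rabs_Ropp.
    eapply Rle_trans; [apply RInt_spec_re_bound; auto; lra|]. right.
    replace (0 * exp T - (0 + a) * T) with (- (a * T)) by ring. ring.
  - apply is_lim_scal_0, is_lim_exp_lin. lra.
Qed.

(** * Sign of the difference of two spectral densities *)

Lemma derive_pos_lt (f df : R -> R) (u v : R) : u < v ->
  (forall x, u <= x <= v -> is_derive f x (df x)) ->
  (forall x, u < x < v -> 0 < df x) -> f u < f v.
Proof.
  intros Huv Hd Hp.
  destruct (MVT_cor2 f df u v Huv) as [c [E Hc]].
  - intros c Hc. apply is_derive_Reals. auto.
  - specialize (Hp c Hc). assert (0 < df c * (v - u)) by (apply Rmult_lt_0_compat; lra). lra.
Qed.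

(** Twice the hyperbolic sine of [a * r]. *)
Definition sinh2 (a r : R) : R := exp (a * r) - exp (- (a * r)).

Lemma sinh2_pos (a r : R) : 0 < a -> 0 < r -> 0 < sinh2 a r.
Proof.
  intros Ha Hr. unfold sinh2. assert (0 < a * r) by (apply Rmult_lt_0_compat; auto).
  assert (exp (- (a * r)) < exp (a * r)) by (apply exp_increasing; lra). lra.
Qed.

(** The quotient [sinh2 b / sinh2 a] increases: the numerator [K] of its derivative vanishes at 0
    and has derivative [(b ^ 2 - a ^ 2) * sinh2 b * sinh2 a]. *)
Lemma sinh2_ratio_incr (a b r1 r2 : R) : 0 < a -> a < b -> 0 < r1 -> r1 < r2 ->
  sinh2 b r1 * sinh2 a r2 < sinh2 b r2 * sinh2 a r1.
Proof.
  intros Ha Hab H1 H12.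
  set (K := fun r => b * (exp (b * r) + exp (- (b * r))) * sinh2 a r
     - sinh2 b r * (a * (exp (a * r) + exp (- (a * r))))).
  assert (HK : forall r, 0 < r -> 0 < K r).
  { intros r Hr. replace 0 with (K 0).
    2: { unfold K, sinh2. rewrite !Rmult_0_r, Ropp_0, exp_0. ring. }
    apply derive_pos_lt with (fun r => (b * b - a * a) * (sinh2 b r * sinh2 a r)); auto.
    - intros x _. unfold K, sinh2. auto_derive; auto. ring.
    - intros x Hx. apply Rmult_lt_0_compat; [|apply Rmult_lt_0_compat; apply sinh2_pos; lra].
      assert (a * a < b * b) by (apply Rmult_le_0_lt_compat; lra). lra. }
  assert (H : sinh2 b r1 / sinh2 a r1 < sinh2 b r2 / sinh2 a r2).
  { apply derive_pos_lt with (f := fun r => sinh2 b r / sinh2 a r)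
      (df := fun r => K r * / (sinh2 a r * sinh2 a r)); auto.
    - intros x Hx. pose proof (sinh2_pos a x Ha ltac:(lra)) as Hs. unfold K. revert Hs. unfold sinh2. intros Hs.
      auto_derive; [lra|]. field. lra.
    - intros x Hx. pose proof (sinh2_pos a x Ha ltac:(lra)) as Hs.
      apply Rmult_lt_0_compat; [apply HK; lra|]. apply Rinv_0_lt_compat, Rmult_lt_0_compat; auto. }
  pose proof (sinh2_pos a r1 Ha H1) as S1. pose proof (sinh2_pos a r2 Ha ltac:(lra)) as S2.
  apply (Rmult_lt_compat_r (sinh2 a r1 * sinh2 a r2)) in H; [|apply Rmult_lt_0_compat; auto].
  replace (sinh2 b r1 / sinh2 a r1 * (sinh2 a r1 * sinh2 a r2)) with (sinh2 b r1 * sinh2 a r2) in H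
    by (field; lra).
  replace (sinh2 b r2 / sinh2 a r2 * (sinh2 a r1 * sinh2 a r2)) with (sinh2 b r2 * sinh2 a r1) in H
    by (field; lra).
  exact H.
Qed.

Lemma sinh2_sq (a r : R) :
  sinh2 (a / 2) r * sinh2 (a / 2) r = exp (a * r) + exp (- a * r) - 2.
Proof.
  unfold sinh2. replace (a * r) with (a / 2 * r + a / 2 * r) by field.
  replace (- a * r) with (- (a / 2 * r) + - (a / 2 * r)) by field.
  rewrite !exp_plus.
  assert (E : exp (a / 2 * r) * exp (- (a / 2 * r)) = 1).
  { rewrite <- exp_plus, Rplus_opp_r. apply exp_0. }
  transitivity (exp (a / 2 * r) * exp (a / 2 * r) + exp (- (a / 2 * r)) * exp (- (a / 2 * r))
     - 2 * (exp (a / 2 * r) * exp (- (a / 2 * r)))); [ring|]. rewrite E. ring.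
Qed.

Definition spec_cmp (a b r : R) : R :=
  sin (a * PI) * (exp (b * r) + 2 * cos (b * PI) + exp (- b * r)) -
  sin (b * PI) * (exp (a * r) + 2 * cos (a * PI) + exp (- a * r)).

Lemma spec_sub (a b r : R) : 0 < a < 1 -> 0 < b < 1 ->
  spec a r - spec b r = spec_cmp a b r *
    / (PI * ((exp (a * r) + 2 * cos (a * PI) + exp (- a * r)) * (exp (b * r) + 2 * cos (b * PI) + exp (- b * r)))).
Proof.
  intros Ha Hb. pose proof PI_RGT_0. pose proof (spec_den_pos a r Ha). pose proof (spec_den_pos b r Hb).
  unfold spec, spec_cmp. field. lra.
Qed.

Lemma spec_even (a r : R) : spec a (- r) = spec a r.
Proof.
  unfold spec. replace (a * - r) with (- a * r) by ring. replace (- a * - r) with (a * r) by ring.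
  f_equal. ring.
Qed.

Lemma sin_mul_PI_pos (a : R) : 0 < a < 1 -> 0 < sin (a * PI).
Proof.
  intros Ha. pose proof PI_RGT_0. apply sin_gt_0; [apply Rmult_lt_0_compat; lra|].
  rewrite <- (Rmult_1_l PI) at 2. apply Rmult_lt_compat_r; lra.
Qed.

(** Half-angle formulas factor the value as [- 8 cos (a PI / 2) cos (b PI / 2) sin ((b - a) PI /
    2)]. *)
Lemma spec_cmp_0 (a b : R) : 0 < a -> a < b -> b < 1 -> spec_cmp a b 0 < 0.
Proof.
  intros Ha Hab Hb. pose proof PI_RGT_0 as HPI. unfold spec_cmp. rewrite !Rmult_0_r, exp_0.
  replace (a * PI) with (2 * (a * (PI / 2))) by field. replace (b * PI) with (2 * (b * (PI / 2))) by field.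
  rewrite !sin_2a, !cos_2a_cos.
  assert (Ca : 0 < cos (a * (PI / 2))).
  { assert (0 < a * (PI / 2)) by (apply Rmult_lt_0_compat; lra).
    assert (a * (PI / 2) < 1 * (PI / 2)) by (apply Rmult_lt_compat_r; lra). apply cos_gt_0; lra. }
  assert (Cb : 0 < cos (b * (PI / 2))).
  { assert (0 < b * (PI / 2)) by (apply Rmult_lt_0_compat; lra).
    assert (b * (PI / 2) < 1 * (PI / 2)) by (apply Rmult_lt_compat_r; lra). apply cos_gt_0; lra. }
  assert (Sab : 0 < sin (b * (PI / 2) - a * (PI / 2))).
  { rewrite <- Rmult_minus_distr_r. apply sin_gt_0; [apply Rmult_lt_0_compat; lra|].
    assert ((b - a) * (PI / 2) < 1 * (PI / 2)) by (apply Rmult_lt_compat_r; lra). lra. }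
  rewrite sin_minus in Sab.
  set (ca := cos (a * (PI / 2))) in *. set (cb := cos (b * (PI / 2))) in *.
  set (sa := sin (a * (PI / 2))) in *. set (sb := sin (b * (PI / 2))) in *.
  assert (0 < 8 * (ca * cb) * (sb * ca - cb * sa)) by (repeat apply Rmult_lt_0_compat; lra).
  lra.
Qed.

Lemma spec_cmp_sinh (a b r : R) : spec_cmp a b r = spec_cmp a b 0
  + sin (a * PI) * (sinh2 (b / 2) r * sinh2 (b / 2) r) - sin (b * PI) * (sinh2 (a / 2) r * sinh2 (a / 2) r).
Proof. rewrite !sinh2_sq. unfold spec_cmp. rewrite !Rmult_0_r, exp_0. ring. Qed.

(** By [spec_cmp_sinh] the function has the form [h + A y ^ 2 - B x ^ 2] with [h < 0 < A]. Divided
    by [x ^ 2] it increases, since [x] and [y / x] do. *)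
Lemma spec_cmp_cross (a b r1 r2 : R) : 0 < a -> a < b -> b < 1 -> 0 < r1 -> r1 < r2 ->
  0 <= spec_cmp a b r1 -> 0 < spec_cmp a b r2.
Proof.
  intros Ha Hab Hb H1 H12. rewrite (spec_cmp_sinh a b r1), (spec_cmp_sinh a b r2).
  pose proof (spec_cmp_0 a b Ha Hab Hb) as H0.
  pose proof (sinh2_ratio_incr (a / 2) (b / 2) r1 r2 ltac:(lra) ltac:(lra) H1 H12) as HR.
  pose proof (sinh2_pos (a / 2) r1 ltac:(lra) H1) as A1. pose proof (sinh2_pos (b / 2) r1 ltac:(lra) H1) as B1.
  pose proof (sinh2_pos (a / 2) r2 ltac:(lra) ltac:(lra)) as A2.
  pose proof (sinh2_pos (b / 2) r2 ltac:(lra) ltac:(lra)) as B2.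
  assert (A12 : sinh2 (a / 2) r1 < sinh2 (a / 2) r2).
  { unfold sinh2. assert (a / 2 * r1 < a / 2 * r2) by (apply Rmult_lt_compat_l; lra).
    assert (exp (a / 2 * r1) < exp (a / 2 * r2)) by (apply exp_increasing; lra).
    assert (exp (- (a / 2 * r2)) < exp (- (a / 2 * r1))) by (apply exp_increasing; lra). lra. }
  pose proof (sin_mul_PI_pos a ltac:(lra)) as Sa.
  set (A := sin (a * PI)) in *. set (B := sin (b * PI)) in *. set (h := spec_cmp a b 0) in *.
  set (x1 := sinh2 (a / 2) r1) in *. set (x2 := sinh2 (a / 2) r2) in *.
  set (y1 := sinh2 (b / 2) r1) in *. set (y2 := sinh2 (b / 2) r2) in *.
  intros Hh.
  assert (K1 : y1 * x2 * (y1 * x2) < y2 * x1 * (y2 * x1)).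
  { apply Rmult_le_0_lt_compat; auto; left; apply Rmult_lt_0_compat; auto. }
  assert (K2 : x1 * x1 < x2 * x2) by (apply Rmult_le_0_lt_compat; lra).
  assert (K3 : A * (y1 * x2 * (y1 * x2)) < A * (y2 * x1 * (y2 * x1))) by (apply Rmult_lt_compat_l; auto).
  assert (K4 : 0 <= (h + A * (y1 * y1) - B * (x1 * x1)) * (x2 * x2)).
  { apply Rmult_le_pos; auto. apply Rle_0_sqr. }
  assert (K5 : h * (x2 * x2) < h * (x1 * x1)).
  { apply Ropp_lt_cancel. rewrite <- !Ropp_mult_distr_l_reverse. apply Rmult_lt_compat_l; lra. }
  assert (0 < x1 * x1) by (apply Rmult_lt_0_compat; auto).
  apply Rmult_lt_reg_r with (x1 * x1); auto. lra.
Qed.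

Lemma spec_cmp_pos_ex (a b : R) : 0 < a -> a < b -> b < 1 -> exists r, 0 < r /\ 0 < spec_cmp a b r.
Proof.
  intros Ha Hab Hb. pose proof (spec_cmp_0 a b Ha Hab Hb) as H0.
  pose proof (sin_mul_PI_pos a ltac:(lra)) as Sa. pose proof (sin_mul_PI_pos b ltac:(lra)) as Sb.
  (* With [exp (b * r) = M * exp (a * r)], this [M] makes the leading term outweigh all the negative
     ones. *)
  set (M := (2 * sin (a * PI) + sin (b * PI) - spec_cmp a b 0) / sin (a * PI)).
  assert (HM : 1 < M).
  { unfold M. apply Rmult_lt_reg_r with (sin (a * PI)); auto. unfold Rdiv.
    rewrite Rmult_assoc, Rinv_l by lra. lra. }
  set (r := ln M / (b - a)).
  assert (Hr : 0 < r).
  { apply Rdiv_lt_0_compat; [|lra]. rewrite <- ln_1. apply ln_increasing; lra. }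
  exists r. split; auto. rewrite spec_cmp_sinh, !sinh2_sq.
  assert (E : exp (b * r) = M * exp (a * r)).
  { rewrite <- (exp_ln M), <- exp_plus by lra. f_equal. unfold r. field. lra. }
  assert (EM : sin (a * PI) * M = 2 * sin (a * PI) + sin (b * PI) - spec_cmp a b 0) by (unfold M; field; lra).
  assert (H1 : 1 <= exp (a * r)).
  { rewrite <- exp_0. apply exp_le_le. apply Rmult_le_pos; lra. }
  assert (H2 : exp (- a * r) <= 1).
  { rewrite <- exp_0. apply exp_le_le. assert (0 <= a * r) by (apply Rmult_le_pos; lra). lra. }
  pose proof (exp_pos (- b * r)) as H3. rewrite E.
  set (A := sin (a * PI)) in *. set (B := sin (b * PI)) in *. set (h := spec_cmp a b 0) in *.
  replace (A * (M * exp (a * r) + exp (- b * r) - 2)) with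
    (A * M * exp (a * r) + A * exp (- b * r) - 2 * A) by ring. rewrite EM.
  assert (0 < A * exp (- b * r)) by (apply Rmult_lt_0_compat; auto).
  assert ((2 * A - h) * 1 <= (2 * A - h) * exp (a * r)) by (apply Rmult_le_compat_l; lra).
  assert (B * exp (- a * r) <= B * 1) by (apply Rmult_le_compat_l; lra). lra.
Qed.

Lemma spec_sign (a b : R) : 0 < a -> a < b -> b < 1 -> exists c, 0 < c /\
  (forall r, Rabs r < c -> spec a r < spec b r) /\ (forall r, c < Rabs r -> spec b r < spec a r).
Proof.
  intros Ha Hab Hb. pose proof PI_RGT_0 as HPI.
  destruct (spec_cmp_pos_ex a b Ha Hab Hb) as [r0 [Hr0 Hp]].
  pose proof (spec_cmp_0 a b Ha Hab Hb) as H0.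
  assert (Hcont : continuity (spec_cmp a b)).
  { intros r. apply continuity_pt_filterlim. change (continuous (spec_cmp a b) r).
    unfold spec_cmp. cont_tac. auto. }
  destruct (IVT _ 0 r0 Hcont Hr0 H0 Hp) as [c [[Hc0 _] Hc]].
  assert (Hcpos : 0 < c).
  { destruct Hc0 as [|E]; auto. rewrite <- E in Hc. lra. }
  assert (Hden : forall r, 0 < / (PI * ((exp (a * r) + 2 * cos (a * PI) + exp (- a * r)) *
      (exp (b * r) + 2 * cos (b * PI) + exp (- b * r))))).
  { intros r. apply Rinv_0_lt_compat. apply Rmult_lt_0_compat; [lra|].
    apply Rmult_lt_0_compat; apply spec_den_pos; lra. }
  assert (Hs : forall r, spec a r - spec b r = spec a (Rabs r) - spec b (Rabs r)).
  { intros r. unfold Rabs. destruct (Rcase_abs r); auto. now rewrite !spec_even. }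
  exists c. split; [auto|split]; intros r Hr; pose proof (Rabs_pos r) as Hr1;
    specialize (Hs r); specialize (Hden (Rabs r)); rewrite (spec_sub a b (Rabs r)) in Hs by lra.
  - assert (Hn : spec_cmp a b (Rabs r) < 0).
    { apply Rnot_le_lt. intros K. destruct Hr1 as [Hr1|Hr1]; [|rewrite <- Hr1 in K; lra].
      pose proof (spec_cmp_cross a b (Rabs r) c Ha Hab Hb Hr1 Hr K). lra. }
    apply (Rmult_lt_compat_r _ _ _ Hden) in Hn. lra.
  - assert (Hn : 0 < spec_cmp a b (Rabs r)) by (apply (spec_cmp_cross a b c); auto; lra).
    apply (Rmult_lt_compat_r _ _ _ Hden) in Hn. lra.
Qed.

(** * Single crossing *)

Definition ml_relax (a x : R) : R := ML a (- Rpower x a).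

(** Strict convexity as an inequality between chord slopes, without denominators, from two mean
    values. *)
Lemma Rpower_chord (rho u v w : R) : 1 < rho -> 0 < u -> u < v -> v < w ->
  (Rpower v rho - Rpower u rho) * (w - v) < (Rpower w rho - Rpower v rho) * (v - u).
Proof.
  intros Hr Hu Huv Hvw.
  assert (Hd : forall x, 0 < x -> derivable_pt_lim (fun z => Rpower z rho) x (rho * Rpower x (rho - 1))).
  { intros x Hx. apply derivable_pt_lim_power; auto. }
  destruct (MVT_cor2 (fun z => Rpower z rho) (fun x => rho * Rpower x (rho - 1)) u v Huv) as [p [Ep Hp]].
  { intros; apply Hd; lra. }
  destruct (MVT_cor2 (fun z => Rpower z rho) (fun x => rho * Rpower x (rho - 1)) v w Hvw) as [q [Eq Hq]].
  { intros; apply Hd; lra. }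
  rewrite Ep, Eq.
  assert (K : Rpower p (rho - 1) < Rpower q (rho - 1)) by (apply Rlt_Rpower_l; lra).
  assert (K2 : 0 < (v - u) * (w - v)) by (apply Rmult_lt_0_compat; lra).
  assert (K3 : rho * Rpower p (rho - 1) < rho * Rpower q (rho - 1)) by (apply Rmult_lt_compat_l; lra).
  apply (Rmult_lt_compat_r _ _ _ K2) in K3. lra.
Qed.

Lemma Rpower_exp (u rho : R) : Rpower (exp u) rho = exp (rho * u).
Proof. unfold Rpower. now rewrite ln_exp. Qed.

Lemma ml_diff_line_int (a b x : R) : 0 < a < 1 -> 0 < b < 1 -> 0 < x ->
  line_int (fun r => exp (- (x * exp r)) * (spec a r - spec b r)) (ml_relax a x - ml_relax b x).
Proof.
  intros Ha Hb Hx.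
  apply line_int_ext with (fun r => exp (- (x * exp r)) * spec a r - exp (- (x * exp r)) * spec b r).
  { intros; ring. }
  apply line_int_minus; apply spec_line_int; auto.
Qed.

Lemma spec_diff_line_int (a b : R) : 0 < a < 1 -> 0 < b < 1 ->
  line_int (fun r => spec a r - spec b r) 0.
Proof.
  intros Ha Hb. replace 0 with (1 - 1) by ring. apply line_int_minus; apply spec_line_int_1; auto.
Qed.

(* With [z = exp (- x e^r)] one has [exp (- y e^r) = z ^ (y / x)]. Subtracting from this convex function of [z] its
   chord between the two sign changes of [spec a - spec b] leaves an integrand of constant sign. *)
Lemma ml_diff_cross (a b x y : R) : 0 < a -> a < b -> b < 1 -> 0 < x -> x < y ->
  0 <= ml_relax a x - ml_relax b x -> 0 < ml_relax a y - ml_relax b y.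
Proof.
  intros Ha Hab Hb Hx Hxy HF.
  destruct (spec_sign a b Ha Hab Hb) as [c [Hc [Hin Hout]]].
  set (z := fun r => exp (- (x * exp r))). set (rho := y / x).
  assert (Hrho : 1 < rho).
  { unfold rho. apply Rmult_lt_reg_r with x; auto. unfold Rdiv. rewrite Rmult_assoc, Rinv_l; lra. }
  assert (Hz : forall r s, r < s -> z s < z r).
  { intros r s Hrs. apply exp_increasing. apply exp_increasing in Hrs.
    apply (Rmult_lt_compat_l x) in Hrs; lra. }
  assert (Hz0 : forall r, 0 < z r) by (intros; apply exp_pos).
  assert (Hy : forall r, exp (- (y * exp r)) = Rpower (z r) rho).
  { intros r. unfold z. rewrite Rpower_exp. f_equal. unfold rho. field. lra. }
  set (f := fun r => Rpower (z r) rho).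
  (* Slope and intercept of the chord. The intercept costs nothing, because the two densities have
     equal total mass. *)
  set (lam := (f (- c) - f c) / (z (- c) - z c)). set (mu := f c - lam * z c).
  assert (Hzc : z c < z (- c)) by (apply Hz; lra).
  assert (Hlam : 0 < lam).
  { apply Rdiv_lt_0_compat; [|lra]. assert (f c < f (- c)); [|lra]. apply Rlt_Rpower_l; [lra|split; auto]. }
  assert (Hlin : line_int (fun r => (exp (- (y * exp r)) * (spec a r - spec b r)
       - lam * (exp (- (x * exp r)) * (spec a r - spec b r))) - mu * (spec a r - spec b r))
     ((ml_relax a y - ml_relax b y) - lam * (ml_relax a x - ml_relax b x) - mu * 0)).
  { apply line_int_minus; [apply line_int_minus|]; try apply line_int_scal;
    try (apply ml_diff_line_int; lra). apply spec_diff_line_int; lra. }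
  assert (E : forall r, (exp (- (y * exp r)) * (spec a r - spec b r)
       - lam * (exp (- (x * exp r)) * (spec a r - spec b r))) - mu * (spec a r - spec b r)
      = (f r - lam * z r - mu) * (spec a r - spec b r)).
  { intros r. rewrite Hy. fold (f r) (z r). ring. }
  assert (Hchord : forall r, (f r - lam * z r - mu) * (z (- c) - z c) =
     (f r - f c) * (z (- c) - z c) - (f (- c) - f c) * (z r - z c)).
  { intros r. unfold mu, lam. field. lra. }
  assert (Hgt : forall r, c < Rabs r -> 0 < (f r - lam * z r - mu) * (spec a r - spec b r)).
  { intros r Hr. specialize (Hout r Hr). apply Rmult_lt_0_compat; [|lra].
    apply Rmult_lt_reg_r with (z (- c) - z c); [lra|]. rewrite Hchord, Rmult_0_l.
    unfold Rabs in Hr. destruct (Rcase_abs r).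
    - assert (K := Rpower_chord rho (z c) (z (- c)) (z r) Hrho (Hz0 c) Hzc ltac:(apply Hz; lra)).
      unfold f. lra.
    - assert (K := Rpower_chord rho (z r) (z c) (z (- c)) Hrho (Hz0 r) ltac:(apply Hz; lra) Hzc).
      unfold f. lra. }
  assert (Hlt : forall r, Rabs r < c -> 0 < (f r - lam * z r - mu) * (spec a r - spec b r)).
  { intros r Hr. specialize (Hin r Hr). apply Rabs_def2 in Hr.
    rewrite <- Rmult_opp_opp. apply Rmult_lt_0_compat; [|lra].
    apply Rmult_lt_reg_r with (z (- c) - z c); [lra|]. rewrite Ropp_mult_distr_l_reverse, Hchord, Rmult_0_l.
    assert (K := Rpower_chord rho (z c) (z r) (z (- c)) Hrho (Hz0 c) ltac:(apply Hz; lra) ltac:(apply Hz; lra)).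
    unfold f. lra. }
  assert (Heq : forall r, Rabs r = c -> f r - lam * z r - mu = 0).
  { intros r Hr. apply Rmult_eq_reg_r with (z (- c) - z c); [|lra]. rewrite Hchord.
    unfold Rabs in Hr. destruct (Rcase_abs r).
    - replace r with (- c) by lra. ring.
    - replace r with c by lra. ring. }
  assert (Hpos : 0 < (ml_relax a y - ml_relax b y) - lam * (ml_relax a x - ml_relax b x) - mu * 0).
  { apply (line_int_gt0 _ _ (c + 1)) with (3 := Hlin).
    - intros r. rewrite E. destruct (Rtotal_order (Rabs r) c) as [H|[H|H]].
      + left; auto.
      + rewrite Heq, Rmult_0_l by auto. lra.
      + left; auto.
    - rewrite E. apply Hgt. rewrite Rabs_pos_eq; lra. }
  assert (0 <= lam * (ml_relax a x - ml_relax b x)) by (apply Rmult_le_pos; lra). lra.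
Qed.

Lemma line_int_reflect (f : R -> R) (l : R) : line_int f l -> line_int (fun r => f (- r)) l.
Proof.
  intros [Hc Hl]. split.
  - intros t. apply (continuous_comp Ropp f); auto. cont_tac; auto.
  - apply is_lim_ext with (2 := Hl). intros T.
    assert (H := RInt_comp_lin f (-1) 0 (- T) T (continuous_ex_RInt f _ _ Hc)).
    replace (-1 * - T + 0) with T in H by ring. replace (-1 * T + 0) with (- T) in H by ring.
    rewrite <- opp_RInt_swap, <- H by (apply continuous_ex_RInt; auto).
    assert (Hc' : forall t, continuous (fun y => f (- y)) t).
    { intros t. apply (continuous_comp Ropp f); auto. cont_tac; auto. }
    rewrite (RInt_ext _ (fun y => -1 * f (- y))).
    + rewrite (RInt_scal_cont (fun y => f (- y))) by auto. unfold opp; simpl. ring.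
    + intros y _. unfold scal; simpl; unfold mult; simpl. do 2 f_equal. ring.
Qed.

(** The derivative is positive exactly when [exp r - exp (- r) > 2 * r], that is [sinh r > r]. *)
Lemma exp_exp_sym_incr (r s : R) : 0 <= r -> r < s ->
  exp (- exp r) + exp (- exp (- r)) < exp (- exp s) + exp (- exp (- s)).
Proof.
  intros Hr Hrs.
  apply derive_pos_lt with (f := fun r => exp (- exp r) + exp (- exp (- r)))
    (df := fun r => exp (- r - exp (- r)) - exp (r - exp r)); auto.
  - intros x _. auto_derive; auto. unfold Rminus. rewrite !exp_plus. ring.
  - intros x Hx. assert (K : exp 0 - exp (- 0) - 2 * 0 < exp x - exp (- x) - 2 * x).
    { apply derive_pos_lt with (f := fun x => exp x - exp (- x) - 2 * x)
        (df := fun x => exp x + exp (- x) - 2); [lra| |].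
      - intros y _. auto_derive; auto. ring.
      - intros y Hy. pose proof (sinh2_sq 1 y) as E. rewrite Rmult_1_l in E.
        replace (- (1) * y) with (- y) in E by ring. rewrite <- E.
        pose proof (sinh2_pos (1 / 2) y ltac:(lra) ltac:(lra)). apply Rmult_lt_0_compat; auto. }
    rewrite Ropp_0 in K. assert (exp (x - exp x) < exp (- x - exp (- x))) by (apply exp_increasing; lra). lra.
Qed.

Lemma exp_exp_sym_Rabs (r : R) :
  exp (- exp r) + exp (- exp (- r)) = exp (- exp (Rabs r)) + exp (- exp (- Rabs r)).
Proof.
  unfold Rabs. destruct (Rcase_abs r); auto. rewrite Ropp_involutive. ring.
Qed.

(** Since the densities are even, twice the difference is an integral against the even function [k],
    which increases with [Rabs r]. Subtracting the constant [k c], free by equality of masses, makes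
    the integrand nonnegative. *)
Lemma ml_diff_1 (a b : R) : 0 < a -> a < b -> b < 1 -> 0 < ml_relax a 1 - ml_relax b 1.
Proof.
  intros Ha Hab Hb. destruct (spec_sign a b Ha Hab Hb) as [c [Hc [Hin Hout]]].
  set (k := fun r => exp (- exp r) + exp (- exp (- r))).
  pose proof (ml_diff_line_int a b 1 ltac:(lra) ltac:(lra) ltac:(lra)) as H1.
  assert (H : line_int (fun r => (k r - k c) * (spec a r - spec b r))
     ((ml_relax a 1 - ml_relax b 1) + (ml_relax a 1 - ml_relax b 1) - k c * 0)).
  { apply line_int_ext with (fun r => (exp (- (1 * exp r)) * (spec a r - spec b r)
      + exp (- (1 * exp (- r))) * (spec a (- r) - spec b (- r))) - k c * (spec a r - spec b r)).
    - intros r. rewrite !spec_even, !Rmult_1_l. unfold k. ring.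
    - apply line_int_minus; [apply line_int_plus; auto|].
      + apply (line_int_reflect _ _ H1).
      + apply line_int_scal, spec_diff_line_int; lra. }
  assert (Hk : forall r, k r = k (Rabs r)) by apply exp_exp_sym_Rabs.
  assert (Hgt : forall r, c < Rabs r -> 0 < (k r - k c) * (spec a r - spec b r)).
  { intros r Hr. specialize (Hout r Hr). apply Rmult_lt_0_compat; [|lra]. rewrite Hk.
    assert (k c < k (Rabs r)); [|lra]. apply exp_exp_sym_incr; lra. }
  assert (0 < (ml_relax a 1 - ml_relax b 1) + (ml_relax a 1 - ml_relax b 1) - k c * 0); [|lra].
  apply (line_int_gt0 _ _ (c + 1)) with (3 := H).
  - intros r. destruct (Rtotal_order (Rabs r) c) as [Hr|[Hr|Hr]].
    + specialize (Hin r Hr). left. rewrite <- Rmult_opp_opp. apply Rmult_lt_0_compat; [|lra].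
      rewrite Hk. assert (k (Rabs r) < k c); [|lra]. apply exp_exp_sym_incr; auto. apply Rabs_pos.
    + rewrite Hk, Hr, Rminus_diag, Rmult_0_l. lra.
    + left; auto.
  - apply Hgt. rewrite Rabs_pos_eq; lra.
Qed.

(** * Monotonicity and positivity of the relaxation functions *)

Lemma ml_relax_decr (a x y : R) : 0 < a < 1 -> 0 < x -> x < y -> ml_relax a y < ml_relax a x.
Proof.
  intros Ha Hx Hxy.
  assert (H : forall r, exp (- (y * exp r)) * spec a r < exp (- (x * exp r)) * spec a r).
  { intros r. apply Rmult_lt_compat_r; [apply spec_pos; auto|]. apply exp_increasing.
    apply Ropp_lt_contravar, Rmult_lt_compat_r; auto. apply exp_pos. }
  apply (line_int_lt _ _ _ _ 0 (fun r => Rlt_le _ _ (H r)) (H 0)); apply spec_line_int; auto; lra.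
Qed.

Lemma ml_relax_pos (a x : R) : 0 < a < 1 -> 0 < x -> 0 < ml_relax a x.
Proof.
  intros Ha Hx.
  assert (H : forall r, 0 < exp (- (x * exp r)) * spec a r).
  { intros r. apply Rmult_lt_0_compat; [apply exp_pos | apply spec_pos; auto]. }
  apply (line_int_gt0 _ _ 0 (fun r => Rlt_le _ _ (H r)) (H 0)). apply spec_line_int; auto.
Qed.

(** * Fractional integral equations *)

Lemma series_tail_bound (u v : nat -> R) (l S : R) (N : nat) :
  (forall n, Rabs (u n) <= v n) -> is_series u l -> is_series v S ->
  Rabs (l - sum_n u N) <= S - sum_n v N.
Proof.
  intros H Hu Hv.
  assert (Hm : forall n, sum_n v n <= S).
  { intros n. apply (is_lim_seq_incr_compare (sum_n v) S); [exact Hv|].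
    intros k. rewrite sum_Sn. change plus with Rplus. specialize (H (Datatypes.S k)).
    pose proof (Rabs_pos (u (Datatypes.S k))). lra. }
  assert (Hd : forall M, Rabs (sum_n u N - sum_n u (M + N)%nat) <= sum_n v (M + N)%nat - sum_n v N).
  { induction M as [|M IH].
    - simpl. rewrite !Rminus_diag, Rabs_R0. lra.
    - simpl Nat.add. rewrite !sum_Sn. change plus with Rplus. specialize (H (Datatypes.S (M + N))).
      replace (sum_n u N - (sum_n u (M + N) + u (Datatypes.S (M + N)))) with
        ((sum_n u N - sum_n u (M + N)) + - u (Datatypes.S (M + N))) by ring.
      eapply Rle_trans; [apply Rabs_triang|]. rewrite Rabs_Ropp. lra. }
  rewrite Rabs_minus_sym.
  apply (is_lim_seq_dist_le (fun M => sum_n u (M + N)%nat) (fun _ => 0)).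
  - apply (is_lim_seq_incr_n (sum_n u) N l). exact Hu.
  - apply is_lim_seq_const.
  - intros M. specialize (Hd M). specialize (Hm (M + N)%nat). lra.
Qed.

Lemma line_int_sum_n (g : nat -> R -> R) (l : nat -> R) (N : nat) :
  (forall n, line_int (g n) (l n)) -> line_int (fun t => sum_n (fun n => g n t) N) (sum_n l N).
Proof.
  intros H. induction N as [|N IH].
  - rewrite sum_O. apply line_int_ext with (2 := H 0%nat). intros t. now rewrite sum_O.
  - rewrite sum_Sn. apply line_int_ext with (fun t => sum_n (fun n => g n t) N + g (S N) t).
    + intros t. now rewrite sum_Sn.
    + apply line_int_plus; auto.
Qed.

Lemma beta_kernel_shift (p q s v : R) :
  beta_kernel p q v * exp (s * (v - ln (1 + exp v))) = beta_kernel p (q + s) v.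
Proof. unfold beta_kernel. rewrite <- exp_plus. f_equal. ring. Qed.

(* Under [t = x e^v / (1 + e^v)], the convolution of [t ^ (p - 1)] and [t ^ (q - 1)] over [0, x] becomes an integral over
   the whole line against [beta_kernel p q]. *)
Lemma beta_PSeries_line_int (c : nat -> R) (p q a X l : R) :
  0 < p -> 0 < q -> 0 < a -> 0 <= X -> (forall z, Rbar_lt (Rabs z) (CV_radius c)) ->
  is_series (fun n => c n * (- X) ^ n * (Gamma p * Gamma (q + INR n * a) / Gamma (p + (q + INR n * a)))) l ->
  line_int (fun v => beta_kernel p q v * PSeries c (- (X * exp (a * (v - ln (1 + exp v)))))) l.
Proof.
  intros Hp Hq Ha HX Hc Hl.
  set (w := fun v => - (X * exp (a * (v - ln (1 + exp v))))).
  set (g := fun n v => c n * (- X) ^ n * beta_kernel p (q + INR n * a) v).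
  assert (Hg : forall n v, g n v = beta_kernel p q v * (c n * w v ^ n)).
  { intros n v. unfold g, w. rewrite <- beta_kernel_shift.
    replace (- (X * exp (a * (v - ln (1 + exp v))))) with (- X * exp (a * (v - ln (1 + exp v)))) by ring.
    rewrite Rpow_mult_distr, pow_exp. rewrite <- (Rmult_assoc (INR n)). ring. }
  assert (Hgn : forall n, line_int (g n)
      (c n * (- X) ^ n * (Gamma p * Gamma (q + INR n * a) / Gamma (p + (q + INR n * a))))).
  { intros n. apply line_int_scal, Beta_line_int; auto.
    assert (0 <= INR n * a) by (apply Rmult_le_pos; [apply pos_INR | lra]). lra. }
  (* The argument [w v] never exceeds [X] in absolute value, so the tail of the absolute series at
     [X] serves as the uniform error. *)
  destruct (CV_disk_inside c X (Hc X)) as [S HS].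
  apply (line_int_approx _ (beta_kernel p q) (fun N v => sum_n (fun n => g n v) N)
     (Gamma p * Gamma q / Gamma (p + q)) l
     (sum_n (fun n => c n * (- X) ^ n * (Gamma p * Gamma (q + INR n * a) / Gamma (p + (q + INR n * a)))))
     (fun N => S - sum_n (fun n => Rabs (c n * X ^ n)) N)).
  - intros v. apply (continuous_mult (beta_kernel p q) (fun v => PSeries c (w v))).
    + apply continuous_beta_kernel.
    + apply (continuous_comp w (PSeries c)).
      * unfold w. cont_tac; auto. apply exp_1p_pos.
      * apply continuity_pt_filterlim, PSeries_continuity, Hc.
  - intros; left; apply beta_kernel_pos.
  - apply Beta_line_int; auto.
  - intros n. apply line_int_sum_n, Hgn.
  - intros N v. fold (w v).
    assert (E : sum_n (fun n => g n v) N = beta_kernel p q v * sum_n (fun n => c n * w v ^ n) N).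
    { rewrite (sum_n_ext _ (fun n => beta_kernel p q v * (c n * w v ^ n))) by (intros; apply Hg).
      apply (sum_n_mult_l (K := R_Ring)). }
    rewrite E, <- Rmult_minus_distr_l, Rabs_mult, Rmult_comm.
    rewrite (Rabs_pos_eq (beta_kernel p q v)) by (left; apply beta_kernel_pos).
    apply Rmult_le_compat_r; [left; apply beta_kernel_pos|].
    apply (series_tail_bound (fun n => c n * w v ^ n) (fun n => Rabs (c n * X ^ n))); auto.
    + intros n. rewrite !Rabs_mult. apply Rmult_le_compat_l; [apply Rabs_pos|].
      rewrite <- !RPow_abs. apply pow_incr. split; [apply Rabs_pos|].
      unfold w. rewrite Rabs_Ropp, Rabs_mult, (Rabs_pos_eq (exp _)) by (left; apply exp_pos).
      rewrite <- (Rmult_1_r (Rabs X)) at 2. apply Rmult_le_compat_l; [apply Rabs_pos|].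
      pose proof (ln_1p_exp_ge v).
      assert (0 <= a * (ln (1 + exp v) - v)) by (apply Rmult_le_pos; lra).
      apply Rle_trans with (exp 0); [apply exp_le_le; lra | rewrite exp_0; lra].
    + exact (proj1 (is_pseries_R c (w v) (PSeries c (w v)))
        (PSeries_correct c (w v) (CV_radius_inside c (w v) (Hc (w v))))).
  - replace (Finite 0) with (Finite (S - S)) by (f_equal; ring).
    apply is_lim_seq_minus'; [apply is_lim_seq_const | exact HS].
  - exact Hl.
Qed.

(* [beta_point x v = x e^v / (1 + e^v)] *)
Definition beta_point (x v : R) : R := x * exp (v - ln (1 + exp v)).

Lemma beta_point_range (x v : R) : 0 < x -> 0 < beta_point x v < x.
Proof.
  intros Hx. unfold beta_point. split; [apply Rmult_lt_0_compat; auto; apply exp_pos|].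
  rewrite <- (Rmult_1_r x) at 2. apply Rmult_lt_compat_l; auto.
  apply Rlt_le_trans with (exp 0); [apply exp_increasing | rewrite exp_0; lra].
  assert (v < ln (1 + exp v)); [|lra]. rewrite <- (ln_exp v) at 1. apply ln_increasing; [apply exp_pos | lra].
Qed.

Lemma ml_relax_beta_point (a x v : R) : 0 < x ->
  ml_relax a (beta_point x v) = PSeries (ml_coef a) (- (Rpower x a * exp (a * (v - ln (1 + exp v))))).
Proof.
  intros Hx. unfold ml_relax. rewrite ML_PSeries. do 2 f_equal. unfold beta_point.
  rewrite <- Rpower_mult_distr, Rpower_exp by (auto; apply exp_pos). reflexivity.
Qed.

Lemma is_series_ml_tail (a x : R) : 0 < a -> 0 < x ->
  is_series (fun n => ml_coef a (S n) * (- Rpower x a) ^ n) ((1 - ml_relax a x) / Rpower x a).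
Proof.
  intros Ha Hx. unfold ml_relax. set (X := Rpower x a). assert (HX : 0 < X) by apply exp_pos.
  assert (H0 : ml_coef a 0 = 1).
  { unfold ml_coef. simpl. rewrite Rmult_0_l, Rplus_0_r, Gamma_1. apply Rinv_1. }
  assert (H : is_series (fun n => ml_coef a (S n) * (- X) ^ S n) (ML a (- X) - 1)).
  { apply (is_series_incr_1 (fun n => ml_coef a n * (- X) ^ n)).
    change plus with Rplus. rewrite H0. simpl pow.
    replace (ML a (- X) - 1 + 1 * 1) with (ML a (- X)) by ring. apply is_series_ML; auto. }
  apply (is_series_scal (- / X)) in H. change scal with Rmult in H.
  replace ((1 - ML a (- X)) / X) with (- / X * (ML a (- X) - 1)) by (field; lra).
  apply is_series_ext with (2 := H). intros n. simpl. eq_R. field. lra.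
Qed.

(** The equation [u + I^a u = 1], termwise: the Beta factor [Gamma a * Gamma (1 + n a) / Gamma (1 +
    (n + 1) a)] turns each coefficient into the next one, up to [Gamma a]. *)
Lemma ml_relax_volterra (a x : R) : 0 < a -> 0 < x ->
  line_int (fun v => beta_kernel a 1 v * ml_relax a (beta_point x v))
    (Gamma a * ((1 - ml_relax a x) / Rpower x a)).
Proof.
  intros Ha Hx.
  apply line_int_ext with (fun v => beta_kernel a 1 v *
    PSeries (ml_coef a) (- (Rpower x a * exp (a * (v - ln (1 + exp v)))))).
  { intros v. now rewrite ml_relax_beta_point. }
  apply beta_PSeries_line_int; auto; try lra.
  - left; apply exp_pos.
  - intros; apply ml_CV_radius; auto.
  - apply is_series_ext with (2 := is_series_scal (Gamma a) _ _ (is_series_ml_tail a x Ha Hx)).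
    intros n. change scal with Rmult. unfold ml_coef.
    assert (0 <= INR n * a) by (apply Rmult_le_pos; [apply pos_INR | lra]).
    replace (a + (1 + INR n * a)) with (1 + INR (S n) * a) by (rewrite S_INR; ring).
    pose proof (Gamma_pos (1 + INR n * a) ltac:(lra)).
    assert (0 < Gamma (1 + INR (S n) * a)) by (apply Gamma_pos; rewrite S_INR; lra).
    eq_R. field. lra.
Qed.

(** In the fractional integral over [[0, x]], the decreasing function is replaced by its smaller
    value at [x]. *)
Lemma ml_relax_upper (a x : R) : 0 < a < 1 -> 0 < x ->
  ml_relax a x * (1 + Rpower x a / Gamma (1 + a)) < 1.
Proof.
  intros Ha Hx. assert (HX : 0 < Rpower x a) by apply exp_pos.
  pose proof (Gamma_pos a ltac:(lra)) as G1. pose proof (Gamma_pos (1 + a) ltac:(lra)) as G2.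
  assert (H : forall v, ml_relax a x * beta_kernel a 1 v < beta_kernel a 1 v * ml_relax a (beta_point x v)).
  { intros v. rewrite Rmult_comm. apply Rmult_lt_compat_l; [apply beta_kernel_pos|].
    destruct (beta_point_range x v Hx). apply ml_relax_decr; auto. }
  assert (K := line_int_lt _ _ _ _ 0 (fun v => Rlt_le _ _ (H v)) (H 0)
    (line_int_scal _ _ (ml_relax a x) (Beta_line_int a 1 ltac:(lra) ltac:(lra)))
    (ml_relax_volterra a x ltac:(lra) Hx)).
  rewrite Gamma_1, (Rplus_comm a) in K.
  apply (Rmult_lt_compat_r (Rpower x a / Gamma a)) in K; [|apply Rdiv_lt_0_compat; auto].
  replace (ml_relax a x * (Gamma a * 1 / Gamma (1 + a)) * (Rpower x a / Gamma a)) with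
    (ml_relax a x * (Rpower x a / Gamma (1 + a))) in K by (field; lra).
  replace (Gamma a * ((1 - ml_relax a x) / Rpower x a) * (Rpower x a / Gamma a)) with
    (1 - ml_relax a x) in K by (field; lra).
  lra.
Qed.

(** This is [ml_relax_decr] read in the variable [z = x ^ a]: a negative derivative would force a
    negative difference quotient. *)
Lemma ml_derive_nonneg (a z : R) : 0 < a < 1 -> 0 < z -> 0 <= PSeries (PS_derive (ml_coef a)) (- z).
Proof.
  intros Ha Hz. apply Rnot_lt_le. intros Hn.
  pose proof (is_derive_PSeries (ml_coef a) (- z) (ml_CV_radius a (- z) ltac:(lra))) as Hd.
  apply is_derive_Reals in Hd. set (D := PSeries (PS_derive (ml_coef a)) (- z)) in *.
  destruct (Hd (- D / 2) ltac:(lra)) as [d Hd'].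
  set (h := Rmin (d / 2) (z / 2)). pose proof (cond_pos d) as Hd0.
  assert (Hh : 0 < h) by (apply Rmin_pos; lra).
  pose proof (Rmin_l (d / 2) (z / 2)) as Hl. pose proof (Rmin_r (d / 2) (z / 2)) as Hr. fold h in Hl, Hr.
  specialize (Hd' h ltac:(lra)). rewrite Rabs_pos_eq in Hd' by lra. specialize (Hd' ltac:(lra)).
  assert (Hml : forall y, 0 < y -> PSeries (ml_coef a) (- y) = ml_relax a (Rpower y (/ a))).
  { intros y Hy. unfold ml_relax. rewrite ML_PSeries, Rpower_mult, Rinv_l, Rpower_1 by lra. reflexivity. }
  assert (K : PSeries (ml_coef a) (- z) < PSeries (ml_coef a) (- z + h)).
  { replace (- z + h) with (- (z - h)) by ring. rewrite !Hml by lra.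
    apply ml_relax_decr; auto; [apply exp_pos|]. apply Rlt_Rpower_l; [apply Rinv_0_lt_compat|]; lra. }
  assert (0 < (PSeries (ml_coef a) (- z + h) - PSeries (ml_coef a) (- z)) / h) by (apply Rdiv_lt_0_compat; lra).
  apply Rabs_def2 in Hd'. lra.
Qed.

(* The two beta integrals below are, up to constant factors, the fractional integral of order [1 - a] and the plain integral
   over [0, x] of minus the derivative of [ml_relax a]. *)
Lemma ml_relax_lower (a x : R) : 0 < a < 1 -> 0 < x ->
  1 <= ml_relax a x * (1 + Gamma (1 - a) * Rpower x a).
Proof.
  intros Ha Hx. set (X := Rpower x a). assert (HX : 0 < X) by apply exp_pos.
  pose proof (Gamma_pos (1 - a) ltac:(lra)) as G1.
  set (e := fun v => PSeries (PS_derive (ml_coef a)) (- (X * exp (a * (v - ln (1 + exp v)))))).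
  assert (He : forall v, 0 <= e v).
  { intros v. apply ml_derive_nonneg; auto. apply Rmult_lt_0_compat; auto. apply exp_pos. }
  assert (Hcv : forall z, Rbar_lt (Rabs z) (CV_radius (PS_derive (ml_coef a)))).
  { intros z. rewrite CV_radius_derive. apply ml_CV_radius; lra. }
  assert (Hn : forall n, 0 < Gamma (INR (S n) * a) /\ Gamma (1 + INR (S n) * a) = INR (S n) * a * Gamma (INR (S n) * a)
     /\ 0 < INR (S n)).
  { intros n. assert (0 < INR (S n)) by (apply lt_0_INR; lia).
    assert (0 < INR (S n) * a) by (apply Rmult_lt_0_compat; lra).
    split; [apply Gamma_pos; auto|split; auto]. now rewrite Gamma_succ. }
  assert (H1 : line_int (fun v => beta_kernel (1 - a) a v * e v) (Gamma (1 - a) / a * ml_relax a x)).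
  { apply beta_PSeries_line_int; auto; try lra.
    apply is_series_ext with (2 := is_series_scal (Gamma (1 - a) / a) _ _ (is_series_ML a (- X) ltac:(lra))).
    intros n. change scal with Rmult. unfold PS_derive, ml_coef. destruct (Hn n) as [Hg [Hc Hs]]. rewrite Hc.
    replace (a + INR n * a) with (INR (S n) * a) by (rewrite S_INR; ring).
    replace (1 - a + INR (S n) * a) with (1 + INR n * a) by (rewrite S_INR; ring).
    assert (0 < Gamma (1 + INR n * a)).
    { apply Gamma_pos. assert (0 <= INR n * a) by (apply Rmult_le_pos; [apply pos_INR | lra]). lra. }
    eq_R. field. lra. }
  assert (H2 : line_int (fun v => beta_kernel 1 a v * e v) (/ a * ((1 - ml_relax a x) / X))).
  { apply beta_PSeries_line_int; auto; try lra.
    apply is_series_ext with (2 := is_series_scal (/ a) _ _ (is_series_ml_tail a x ltac:(lra) Hx)).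
    intros n. fold X. change scal with Rmult. unfold PS_derive, ml_coef. rewrite Gamma_1.
    replace (a + INR n * a) with (INR (S n) * a) by (rewrite S_INR; ring).
    destruct (Hn n) as [Hg [Hc Hs]]. rewrite Hc. eq_R. field. lra. }
  (* The kernels differ by the factor [(1 + exp v) ^ (- a)], which is [(1 - t / x) ^ a] and at most
     1. *)
  assert (Hle : / a * ((1 - ml_relax a x) / X) <= Gamma (1 - a) / a * ml_relax a x).
  { apply (line_int_le _ _ _ _) with (2 := H2) (3 := H1). intros v. apply Rmult_le_compat_r; auto.
    unfold beta_kernel. apply exp_le_le. pose proof (ln_1p_exp_pos v).
    assert (0 <= a * ln (1 + exp v)) by (apply Rmult_le_pos; lra). lra. }
  apply (Rmult_le_compat_r (a * X)) in Hle; [|left; apply Rmult_lt_0_compat; lra].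
  replace (/ a * ((1 - ml_relax a x) / X) * (a * X)) with (1 - ml_relax a x) in Hle by (field; lra).
  replace (Gamma (1 - a) / a * ml_relax a x * (a * X)) with (ml_relax a x * (Gamma (1 - a) * X)) in Hle by (field; lra).
  lra.
Qed.

(** * Location of the zero *)

(** Phrased through [ln (1 + exp v)], the variable in which the ratio of two fractional kernels is
    exponential. *)
Lemma beta_point_incr (x v w : R) : 0 < x ->
  ln (1 + exp v) < ln (1 + exp w) -> beta_point x v < beta_point x w.
Proof.
  intros Hx H. unfold beta_point. apply Rmult_lt_compat_l; auto.
  assert (E : forall u, exp (u - ln (1 + exp u)) = 1 - / (1 + exp u)).
  { intros u. unfold Rminus at 1. rewrite exp_plus, exp_Ropp, exp_ln by apply exp_1p_pos. field.
    apply Rgt_not_eq, exp_1p_pos. }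
  rewrite !E. apply ln_lt_inv in H; try apply exp_1p_pos.
  assert (/ (1 + exp w) < / (1 + exp v)); [|lra].
  apply Rinv_lt_contravar; auto. apply Rmult_lt_0_compat; apply exp_1p_pos.
Qed.

(** The Riemann-Liouville kernel [(x - t) ^ (a - 1) / Gamma a dt] at [t = beta_point x v]. *)
Definition frac_kernel (a x v : R) : R := Rpower x a / Gamma a * beta_kernel a 1 v.

Lemma frac_kernel_line_int (a x : R) : 0 < a ->
  line_int (frac_kernel a x) (Rpower x a / Gamma (1 + a)).
Proof.
  intros Ha. pose proof (Gamma_pos a Ha). pose proof (Gamma_pos (1 + a) ltac:(lra)).
  replace (Rpower x a / Gamma (1 + a)) with (Rpower x a / Gamma a * (Gamma a * Gamma 1 / Gamma (a + 1))).
  - apply line_int_scal, Beta_line_int; lra.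
  - rewrite Gamma_1, (Rplus_comm a). field. lra.
Qed.

Lemma frac_kernel_volterra (a x : R) : 0 < a -> 0 < x ->
  line_int (fun v => frac_kernel a x v * ml_relax a (beta_point x v)) (1 - ml_relax a x).
Proof.
  intros Ha Hx. pose proof (Gamma_pos a Ha). assert (0 < Rpower x a) by apply exp_pos.
  assert (K := line_int_scal _ _ (Rpower x a / Gamma a) (ml_relax_volterra a x Ha Hx)).
  replace (1 - ml_relax a x) with (Rpower x a / Gamma a * (Gamma a * ((1 - ml_relax a x) / Rpower x a)))
    by (field; lra).
  apply line_int_ext with (2 := K). intros v. unfold frac_kernel. ring.
Qed.

Lemma frac_kernel_pos (a x v : R) : 0 < a -> 0 < frac_kernel a x v.
Proof.
  intros Ha. apply Rmult_lt_0_compat; [|apply beta_kernel_pos].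
  apply Rdiv_lt_0_compat; [apply exp_pos | apply Gamma_pos; auto].
Qed.

Lemma frac_kernel_ratio (a b x v : R) : 0 < a -> 0 < b ->
  frac_kernel a x v = frac_kernel b x v *
    exp (ln (Rpower x a / Gamma a * (Gamma b / Rpower x b)) + (b - a) * ln (1 + exp v)).
Proof.
  intros Ha Hb. pose proof (Gamma_pos a Ha). pose proof (Gamma_pos b Hb).
  assert (0 < Rpower x a) by apply exp_pos. assert (0 < Rpower x b) by apply exp_pos.
  rewrite exp_plus, exp_ln by (repeat apply Rmult_lt_0_compat; auto; apply Rinv_0_lt_compat; auto).
  unfold frac_kernel.
  replace (beta_kernel a 1 v) with (beta_kernel b 1 v * exp ((b - a) * ln (1 + exp v))).
  - field. lra.
  - unfold beta_kernel. rewrite <- exp_plus. f_equal. ring.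
Qed.

Lemma frac_kernel_lt (a b x v : R) : 0 < a -> 0 < b ->
  0 < ln (Rpower x a / Gamma a * (Gamma b / Rpower x b)) + (b - a) * ln (1 + exp v) ->
  frac_kernel b x v < frac_kernel a x v.
Proof.
  intros Ha Hb H. rewrite (frac_kernel_ratio a b) by auto.
  rewrite <- (Rmult_1_r (frac_kernel b x v)) at 1.
  apply Rmult_lt_compat_l; [apply frac_kernel_pos; auto|]. rewrite <- exp_0 at 1. now apply exp_increasing.
Qed.

Lemma frac_kernel_gt (a b x v : R) : 0 < a -> 0 < b ->
  ln (Rpower x a / Gamma a * (Gamma b / Rpower x b)) + (b - a) * ln (1 + exp v) < 0 ->
  frac_kernel a x v < frac_kernel b x v.
Proof.
  intros Ha Hb H. rewrite (frac_kernel_ratio a b) by auto.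
  rewrite <- (Rmult_1_r (frac_kernel b x v)) at 2.
  apply Rmult_lt_compat_l; [apply frac_kernel_pos; auto|].
  apply Rlt_le_trans with (exp 0); [now apply exp_increasing | rewrite exp_0; lra].
Qed.

(* At a zero [x] of the difference both Volterra integrals agree. Replacing [ml_relax a] by the larger [ml_relax b], which
   decreases, Chebyshev's inequality compares the total masses of the two kernels, whose ratio is monotone. *)
Lemma ml_zero_upper (a b x : R) : 0 < a -> a < b -> b < 1 -> 0 < x ->
  ml_relax a x = ml_relax b x ->
  (forall t, 0 < t < x -> ml_relax a t < ml_relax b t) ->
  Rpower x b / Gamma (1 + b) < Rpower x a / Gamma (1 + a).
Proof.
  intros Ha Hab Hb Hx Heq Hlt. apply Rnot_le_lt. intros Hle.
  set (w := fun v => ml_relax b (beta_point x v)).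
  set (C := ln (Rpower x a / Gamma a * (Gamma b / Rpower x b))).
  pose proof (frac_kernel_line_int a x Ha) as Ka.
  pose proof (frac_kernel_line_int b x ltac:(lra)) as Kb.
  pose proof (frac_kernel_volterra a x Ha Hx) as Va.
  pose proof (frac_kernel_volterra b x ltac:(lra) Hx) as Vb. fold w in Vb.
  pose proof ln_1p_exp_pos as HL.
  (* [C] is the infimum of the logarithm of the kernel ratio, approached as [v] tends to minus
     infinity. If [0 <= C], the kernel of order [a] dominates everywhere and the masses contradict
     [Hle]. *)
  destruct (Rle_lt_dec 0 C) as [HC|HC].
  - assert (H : forall v, frac_kernel b x v < frac_kernel a x v).
    { intros v. apply frac_kernel_lt; try lra. fold C.
      assert (0 < (b - a) * ln (1 + exp v)) by (apply Rmult_lt_0_compat; [lra | apply HL]). lra. }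
    pose proof (line_int_lt _ _ _ _ 0 (fun v => Rlt_le _ _ (H v)) (H 0) Kb Ka). lra.
  (* The kernels cross where [ln (1 + exp v) = Ls], that is at [vs]. *)
  - set (Ls := - C / (b - a)).
    assert (HLs : 0 < Ls) by (apply Rdiv_lt_0_compat; lra).
    set (vs := ln (exp Ls - 1)).
    assert (Hvs : ln (1 + exp vs) = Ls).
    { unfold vs. rewrite exp_ln.
      - replace (1 + (exp Ls - 1)) with (exp Ls) by ring. apply ln_exp.
      - pose proof (exp_ineq1_le Ls). lra. }
    assert (HCL : forall v, C + (b - a) * ln (1 + exp v) = (b - a) * (ln (1 + exp v) - Ls)).
    { intros v. unfold Ls. field. lra. }
    assert (Hpt : forall v, 0 < beta_point x v < x) by (intros; apply beta_point_range; auto).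
    set (W := w vs).
    assert (HW : 0 < W) by exact (ml_relax_pos b (beta_point x vs) ltac:(lra) (proj1 (Hpt vs))).
    (* On either side of [vs], the factor [w - W] and the difference of the kernels have opposite
       signs. The left side integrates to 0 by [Heq], so the mass of order [a] must be the
       larger. *)
    assert (H1 : forall v, frac_kernel a x v * ml_relax a (beta_point x v) - frac_kernel b x v * w v
       < W * (frac_kernel a x v - frac_kernel b x v)).
    { intros v. pose proof (frac_kernel_pos a x v Ha).
      apply Rlt_le_trans with (frac_kernel a x v * w v - frac_kernel b x v * w v).
      - assert (frac_kernel a x v * ml_relax a (beta_point x v) < frac_kernel a x v * w v); [|lra].
        apply Rmult_lt_compat_l; [exact H | apply Hlt, Hpt].
      - rewrite <- Rmult_minus_distr_r, Rmult_comm.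
        destruct (Rtotal_order (ln (1 + exp v)) Ls) as [HH|[HH|HH]].
        + assert (frac_kernel a x v < frac_kernel b x v).
          { apply frac_kernel_gt; try lra. fold C. rewrite HCL.
            assert (0 < (b - a) * (Ls - ln (1 + exp v))) by (apply Rmult_lt_0_compat; lra). lra. }
          assert (W < w v).
          { apply (ml_relax_decr b (beta_point x v) (beta_point x vs) ltac:(lra) (proj1 (Hpt v))).
            apply beta_point_incr; auto. now rewrite Hvs. }
          assert (0 < (w v - W) * (frac_kernel b x v - frac_kernel a x v)) by (apply Rmult_lt_0_compat; lra). lra.
        + assert (v = vs) as ->; [|fold W; lra].
          rewrite <- Hvs in HH. apply ln_inv in HH; try apply exp_1p_pos. apply exp_inv. lra.
        + assert (frac_kernel b x v < frac_kernel a x v).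
          { apply frac_kernel_lt; try lra. fold C. rewrite HCL. apply Rmult_lt_0_compat; lra. }
          assert (w v < W).
          { apply (ml_relax_decr b (beta_point x vs) (beta_point x v) ltac:(lra) (proj1 (Hpt vs))).
            apply beta_point_incr; auto. now rewrite Hvs. }
          assert (0 < (W - w v) * (frac_kernel a x v - frac_kernel b x v)) by (apply Rmult_lt_0_compat; lra). lra. }
    pose proof (line_int_lt _ _ _ _ 0 (fun v => Rlt_le _ _ (H1 v)) (H1 0)
      (line_int_minus _ _ _ _ Va Vb) (line_int_scal _ _ W (line_int_minus _ _ _ _ Ka Kb))) as K.
    assert (0 <= W * (Rpower x b / Gamma (1 + b) - Rpower x a / Gamma (1 + a))) by (apply Rmult_le_pos; lra).
    lra.
Qed.

(** The logarithmic variable gives continuity on the whole line, as the intermediate value theorem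
    used for the zero requires. *)
Lemma continuity_ml_relax_exp (a : R) : 0 < a -> continuity (fun t => ml_relax a (exp t)).
Proof.
  intros Ha t. apply continuity_pt_filterlim. change (continuous (fun t => ml_relax a (exp t)) t).
  apply continuous_ext with (fun t => PSeries (ml_coef a) (- exp (a * t))).
  { intros u. unfold ml_relax. now rewrite ML_PSeries, Rpower_exp. }
  apply (continuous_comp (fun t => - exp (a * t)) (PSeries (ml_coef a))).
  - cont_tac; auto.
  - apply continuity_pt_filterlim, PSeries_continuity, ml_CV_radius; auto.
Qed.

Lemma Rpower_root (y d : R) : 0 < y -> d <> 0 -> Rpower (Rpower y (1 / d)) d = y.
Proof.
  intros Hy Hd. rewrite Rpower_mult. replace (1 / d * d) with 1 by (field; auto). apply Rpower_1; auto.
Qed.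

Theorem theoremB :
  forall alpha beta : R, 0 < alpha -> alpha < beta -> beta < 1 ->
  exists x0 : R, 0 < x0 < 1 /\
    (forall x, 0 < x < x0 ->
       ML alpha (- Rpower x alpha) - ML beta (- Rpower x beta) < 0) /\
    (forall x, x0 < x ->
       ML alpha (- Rpower x alpha) - ML beta (- Rpower x beta) > 0) /\
    Rpower (1 / (Gamma (1 - beta) * Gamma (1 + alpha))) (1 / (beta - alpha)) < x0 /\
    x0 < Rpower (Gamma (1 + beta) / Gamma (1 + alpha)) (1 / (beta - alpha)).
Proof.
  intros a b Ha Hab Hb.
  set (F := fun x => ml_relax a x - ml_relax b x).
  change (exists x0 : R, 0 < x0 < 1 /\ (forall x, 0 < x < x0 -> F x < 0) /\ (forall x, x0 < x -> F x > 0) /\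
    Rpower (1 / (Gamma (1 - b) * Gamma (1 + a))) (1 / (b - a)) < x0 /\
    x0 < Rpower (Gamma (1 + b) / Gamma (1 + a)) (1 / (b - a))).
  pose proof (Gamma_pos (1 - b) ltac:(lra)) as G1. pose proof (Gamma_pos (1 + a) ltac:(lra)) as G2.
  pose proof (Gamma_pos (1 + b) ltac:(lra)) as G3.
  assert (Hcross : forall x y, 0 < x -> x < y -> 0 <= F x -> 0 < F y).
  { intros x y Hx Hxy. exact (ml_diff_cross a b x y Ha Hab Hb Hx Hxy). }
  assert (F1 : 0 < F 1) by exact (ml_diff_1 a b Ha Hab Hb).
  set (m := 1 / (Gamma (1 - b) * Gamma (1 + a))).
  assert (Hm : 0 < m) by (apply Rdiv_lt_0_compat; [lra | apply Rmult_lt_0_compat; auto]).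
  set (xm := Rpower m (1 / (b - a))). assert (Hxm : 0 < xm) by apply exp_pos.
  assert (Fm : F xm < 0).
  (* The choice of [m] equates [Gamma (1 - b) * xm ^ b] with [xm ^ a / Gamma (1 + a)], so the upper
     bound on [ml_relax a xm] and the lower bound on [ml_relax b xm] share their denominator. *)
  { assert (E : Rpower xm b = m * Rpower xm a).
    { replace b with ((b - a) + a) at 1 by ring. rewrite Rpower_plus. unfold xm at 1.
      rewrite Rpower_root by lra. reflexivity. }
    pose proof (ml_relax_upper a xm ltac:(lra) Hxm) as Hu. pose proof (ml_relax_lower b xm ltac:(lra) Hxm) as Hl.
    assert (HX : 0 < Rpower xm a) by apply exp_pos.
    replace (Gamma (1 - b) * Rpower xm b) with (Rpower xm a / Gamma (1 + a)) in Hl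
      by (rewrite E; unfold m; field; lra).
    assert (HY : 0 < Rpower xm a / Gamma (1 + a)) by (apply Rdiv_lt_0_compat; auto).
    unfold F. assert (ml_relax a xm < ml_relax b xm); [|lra].
    apply Rmult_lt_reg_r with (1 + Rpower xm a / Gamma (1 + a)); lra. }
  (* Positivity at 1 would propagate by [Hcross] to any larger [xm], against [Fm]. *)
  assert (Hxm1 : xm < 1).
  { apply Rnot_le_lt. intros [K|K]; [|rewrite <- K in Fm; lra].
    pose proof (Hcross 1 xm ltac:(lra) K ltac:(lra)). lra. }
  assert (Hcont : continuity (fun t => F (exp t))).
  { exact (continuity_minus _ _ (continuity_ml_relax_exp a Ha) (continuity_ml_relax_exp b ltac:(lra))). }
  destruct (IVT (fun t => F (exp t)) (ln xm) 0 Hcont) as [t [_ Ht]].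
  { rewrite <- ln_1. apply ln_increasing; auto. }
  { rewrite exp_ln; auto. }
  { rewrite exp_0; auto. }
  set (x0 := exp t) in *. assert (Hx0 : 0 < x0) by apply exp_pos.
  assert (Hneg : forall x, 0 < x < x0 -> F x < 0).
  { intros x Hx. apply Rnot_le_lt. intros K. pose proof (Hcross x x0 ltac:(lra) ltac:(lra) K). lra. }
  assert (Hpos : forall x, x0 < x -> 0 < F x) by (intros x Hx; apply (Hcross x0); auto; lra).
  exists x0. repeat split; auto.
  - apply Rnot_le_lt. intros [K|K]; [specialize (Hneg 1 ltac:(lra)); lra | rewrite K in F1; lra].
  - apply Rnot_le_lt. intros [K|K]; [specialize (Hpos xm K); lra | rewrite <- K in Fm; lra].
  - assert (K : Rpower x0 b / Gamma (1 + b) < Rpower x0 a / Gamma (1 + a)).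
    { apply ml_zero_upper; auto; [unfold F in Ht; lra|].
      intros u Hu. specialize (Hneg u Hu). unfold F in Hneg. lra. }
    replace b with ((b - a) + a) in K at 1 by ring. rewrite Rpower_plus in K.
    assert (HX : 0 < Rpower x0 a) by apply exp_pos.
    assert (K2 : Rpower x0 (b - a) < Gamma (1 + b) / Gamma (1 + a)).
    { apply (Rmult_lt_compat_r (Gamma (1 + b) / Rpower x0 a)) in K; [|apply Rdiv_lt_0_compat; auto].
      replace (Rpower x0 (b - a) * Rpower x0 a / Gamma (1 + b) * (Gamma (1 + b) / Rpower x0 a))
        with (Rpower x0 (b - a)) in K by (field; lra).
      replace (Rpower x0 a / Gamma (1 + a) * (Gamma (1 + b) / Rpower x0 a))
        with (Gamma (1 + b) / Gamma (1 + a)) in K by (field; lra). exact K. }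
    replace x0 with (Rpower (Rpower x0 (b - a)) (1 / (b - a))) at 1.
    + apply Rlt_Rpower_l; [apply Rdiv_lt_0_compat; lra|]. split; auto. apply exp_pos.
    + rewrite Rpower_mult. replace ((b - a) * (1 / (b - a))) with 1 by (field; lra). apply Rpower_1; auto.
Qed.
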